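(* Let $(C_\rho)_{\rho\in[-1,1]}$ be a family of bivariate elliptical copulas with density generator $g$. Then the following statements hold true for $\rho,\rho'\in[-1,1]$. (i) $\rho\leq\rho'$ if and only if $C_\rho\leq_{lo}C_{\rho'}$. (ii) Suppose $|\rho|\in[0,1)$, and let $\phi(t):=\log(g(t))$ be twice differentiable and $T:=\{t\in\mathbb{R}_+:\phi'(t)<0\}$. If $$-\frac{|\rho|}{1+|\rho|}\leq\inf_{t\in T}\frac{t\,\phi''(t)}{\phi'(t)}\leq\sup_{t\in T}\frac{t\,\phi''(t)}{\phi'(t)}\leq\frac{|\rho|}{1-|\rho|},$$ and $\phi''(t)=0$ for every $t$ with $\phi'(t)=0$, then $|\rho|\leq|\rho'|$ implies $C_\rho\leq_{\partial S}C_{\rho'}$.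
   Context: A bivariate copula is a function $C:[0,1]^2\to[0,1]$ that is grounded, $2$-increasing and has uniform marginals. $\partial_i$ denotes the partial derivative with respect to the $i$th component (defined almost everywhere in that component). Elliptical copulas with density generator $g$: for $\rho\in(-1,1)$, $C_\rho$ is the copula (obtained via Sklar's theorem) of the bivariate elliptical distribution with location $0$ and scale matrix $\Sigma=\begin{pmatrix}1&\rho\\\rho&1\end{pmatrix}$ having Lebesgue density proportional to $(1-\rho^2)^{-1/2}\,g\left(\frac{x^2-2\rho xy+y^2}{1-\rho^2}\right)$, where $g:\mathbb{R}_+\to\mathbb{R}_+$ is the same for all $\rho$. Equivalently $X=RAU$ with $AA^T=\Sigma$, $U$ uniform on the unit circle and $R\geq0$ independent of $U$ with law determined by $g$. For $\rho=1$ and $\rho=-1$ (degenerate case), $C_1(u,v)=\min\{u,v\}$ and $C_{-1}(u,v)=\max\{u+v-1,0\}$. Lower orthant order: $D\leq_{lo}E$ means $D(u,v)\leq E(u,v)$ for all $(u,v)\in[0,1]^2$. Schur order for functions: for an integrable $h:(0,1)\to\mathbb{R}$, let $h^*$ denote its decreasing rearrangement, i.e. the essentially unique decreasing function with $\lambda(h^*\geq w)=\lambda(h\geq w)$ for all $w\in\mathbb{R}$, where $\lambda$ is Lebesgue measure on $(0,1)$. For integrable $f,h:(0,1)\to\mathbb{R}$, write $f\prec_S h$ if $\int_0^x f^*(t)\,dt\leq\int_0^x h^*(t)\,dt$ for all $x\in(0,1)$ and $\int_0^1 f^*(t)\,dt=\int_0^1 h^*(t)\,dt$. Schur order for copula derivatives: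 $D\leq_{\partial_1 S}E$ if $\partial_1 D(\cdot,v)\prec_S\partial_1E(\cdot,v)$ for all $v\in(0,1)$; $D\leq_{\partial_2 S}E$ if $\partial_2 D(v,\cdot)\prec_S\partial_2E(v,\cdot)$ for all $v\in(0,1)$; $D\leq_{\partial S}E$ if both hold. *)

(* Defs.v *)
From HB Require Import structures.
From mathcomp Require Import all_boot all_order all_algebra.
From mathcomp Require Import all_classical all_reals all_analysis.

Set Implicit Arguments.
Unset Strict Implicit.
Unset Printing Implicit Defensive.

Import Order.TTheory GRing.Theory Num.Theory.
Import numFieldNormedType.Exports.

Local Open Scope classical_set_scope.
Local Open Scope ring_scope.

Section Copulas.
Context {R : realType}.

(* Functions on [0,1]^2 (resp. on (0,1), on [0,+oo[) are represented by total
   functions on the reals; only their values on that domain are ever used. *)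

Definition grounded (C : R -> R -> R) : Prop :=
  forall u : R, 0 <= u <= 1 -> C u 0 = 0 /\ C 0 u = 0.

Definition uniform_marginals (C : R -> R -> R) : Prop :=
  forall u : R, 0 <= u <= 1 -> C u 1 = u /\ C 1 u = u.

Definition two_increasing (C : R -> R -> R) : Prop :=
  forall u1 u2 v1 v2 : R,
    0 <= u1 -> u1 <= u2 -> u2 <= 1 -> 0 <= v1 -> v1 <= v2 -> v2 <= 1 ->
    0 <= C u2 v2 - C u2 v1 - C u1 v2 + C u1 v1.

Definition is_copula (C : R -> R -> R) : Prop :=
  [/\ forall u v : R, 0 <= u <= 1 -> 0 <= v <= 1 -> 0 <= C u v <= 1,
      grounded C, uniform_marginals C & two_increasing C].

Definition joint_cdf (P : probability (R * R)%type R) (x y : R) : R :=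
  fine (P (`]-oo, x] `*` `]-oo, y])).

Definition marginal_cdf1 (P : probability (R * R)%type R) (x : R) : R :=
  fine (P (`]-oo, x] `*` setT)).

Definition marginal_cdf2 (P : probability (R * R)%type R) (y : R) : R :=
  fine (P (setT `*` `]-oo, y])).

(* Sklar's relation; it determines C on [0,1]^2 when the marginals are
   continuous. *)
Definition copula_of (P : probability (R * R)%type R) (C : R -> R -> R) : Prop :=
  is_copula C /\
  forall x y : R, joint_cdf P x y = C (marginal_cdf1 P x) (marginal_cdf2 P y).

Definition density_generator (g : R -> R) : Prop :=
  measurable_fun (`[0, +oo[ : set R) g /\ forall t : R, 0 <= t -> 0 <= g t.

Definition elliptical_density (g : R -> R) (rho : R) (z : R * R) : R :=
  (Num.sqrt (1 - rho ^+ 2))^-1 *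
  g ((z.1 ^+ 2 - 2 * rho * z.1 * z.2 + z.2 ^+ 2) / (1 - rho ^+ 2)).

Definition elliptical_law (g : R -> R) (rho : R)
    (P : probability (R * R)%type R) : Prop :=
  exists2 c : R, 0 < c &
    forall A : set (R * R), measurable A ->
      P A = (\int[(lebesgue_measure \x lebesgue_measure)%E]_(z in A)
               (c * elliptical_density g rho z)%:E)%E.

Definition elliptical_copula_family (g : R -> R) (C : R -> R -> R -> R) : Prop :=
  [/\ forall rho : R, -1 < rho -> rho < 1 ->
        exists2 P : probability (R * R)%type R,
          elliptical_law g rho P & copula_of P (C rho),
      forall u v : R, 0 <= u <= 1 -> 0 <= v <= 1 ->
        C 1 u v = Num.min u v
    & forall u v : R, 0 <= u <= 1 -> 0 <= v <= 1 ->
        C (-1) u v = Num.max (u + v - 1) 0].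

Definition lower_orthant_le (D E : R -> R -> R) : Prop :=
  forall u v : R, 0 <= u <= 1 -> 0 <= v <= 1 -> D u v <= E u v.

Definition is_decreasing_rearrangement (h hs : R -> R) : Prop :=
  (forall s t : R, 0 < s -> s <= t -> t < 1 -> hs t <= hs s) /\
  forall w : R,
    lebesgue_measure (`]0, 1[ `&` [set t | w <= hs t]) =
    lebesgue_measure (`]0, 1[ `&` [set t | w <= h t]).

(* The decreasing rearrangement of an integrable function exists and is unique
   almost everywhere, so the integrals below do not depend on fs and hs. *)
Definition schur_le (f h : R -> R) : Prop :=
  [/\ lebesgue_measure.-integrable `]0, 1[ (EFin \o f),
      lebesgue_measure.-integrable `]0, 1[ (EFin \o h)
    & exists fs hs : R -> R,
      [/\ is_decreasing_rearrangement f fs,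
          is_decreasing_rearrangement h hs,
          forall x : R, 0 < x -> x < 1 ->
            (\int[lebesgue_measure]_(t in `]0%R, x[) (fs t)%:E <=
             \int[lebesgue_measure]_(t in `]0%R, x[) (hs t)%:E)%E
        & (\int[lebesgue_measure]_(t in `]0%R, 1%R[) (fs t)%:E =
           \int[lebesgue_measure]_(t in `]0%R, 1%R[) (hs t)%:E)%E]].

(* A copula is differentiable in each component only almost everywhere; at the
   remaining points the library derivative has an unspecified value, which
   changes neither the integrability nor the rearrangement. *)
Definition schur_le_d1 (D E : R -> R -> R) : Prop :=
  forall v : R, 0 < v -> v < 1 ->
    schur_le (derive1 (fun t => D t v)) (derive1 (fun t => E t v)).

Definition schur_le_d2 (D E : R -> R -> R) : Prop :=
  forall v : R, 0 < v -> v < 1 ->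
    schur_le (derive1 (fun t => D v t)) (derive1 (fun t => E v t)).

Definition schur_le_d (D E : R -> R -> R) : Prop :=
  schur_le_d1 D E /\ schur_le_d2 D E.

(* Differentiation on [0,+oo[, one-sided at 0. *)
Definition Rplus_quotient (f : R -> R) (t s : R) : R := (f s - f t) / (s - t).

Definition derivable_Rplus (f : R -> R) : Prop :=
  forall t : R, 0 <= t ->
    cvg (Rplus_quotient f t s @[s --> within `[0, +oo[ t^']).

Definition derive_Rplus (f : R -> R) (t : R) : R :=
  lim (Rplus_quotient f t s @[s --> within `[0, +oo[ t^']).

End Copulas.

(* Main.v *)
From HB Require Import structures.
Require Import Defs.
From mathcomp Require Import all_boot all_order all_algebra.
From mathcomp Require Import all_classical all_reals all_analysis.
From mathcomp Require Import measurable_realfun ring lra.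
Import Order.TTheory GRing.Theory Num.Theory.
Import numFieldNormedType.Exports.
Local Open Scope classical_set_scope.
Local Open Scope ring_scope.
Set Implicit Arguments.
Unset Strict Implicit.
Unset Printing Implicit Defensive.

(** With z a spherically symmetric vector of density c g(|z|^2), C_rho is the copula
   of (z.1, rho z.1 + sqrt (1 - rho^2) z.2), the projections of z on two unit
   vectors.  (i) The reflection exchanging the second unit vectors for rho and rho'
   preserves the law of z and maps the quadrant for rho minus the quadrant for rho'
   into the quadrant for rho', hence monotonicity in rho; it is strict at (1/2, 1/2),
   where the quadrants differ by a sector, and a sector has positive mass because
   the law of the slope z.2 / z.1 is proportional to dt / (1 + t^2).
   (ii) The bounds on t phi'' / phi' force phi' < 0 on ]0, +oo[ and make the density
   log-supermodular for every correlation r with |rho| <= r < 1.  So the conditional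
   distribution function of Y given X = x decreases in x, and d_1 C_r(., v) is
   its own decreasing rearrangement.  For a negative correlation it is
   reflected by t |-> 1 - t, which does not change the rearrangement.
   Integrating, the Schur order becomes the pointwise order of C_|rho| and
   C_|rho'|, which is (i). *)

(** * Linear changes of variables for the Lebesgue measure *)

(** The boundary of the square, where no quantile need exist, and the degenerate copulas are settled
    by the Frechet-Hoeffding bounds. In (ii) put N = x^2 - 2 r x y + y^2, t = N / (1 - r^2) and k =
    t phi''(t) / phi'(t). As phi' < 0, the mixed derivative of phi(t) in x and y is nonnegative iff
    2 k (x - r y)(y - r x) <= r N. Since 2 (x - r y)(y - r x) ranges from -(1 + r) N to (1 - r) N,
    this means -r / (1 + r) <= k <= r / (1 - r), whence the two bounds. Their interval grows with r,
    so the bounds at |rho| serve every larger correlation. The derivative of the copula is found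
    without dividing by a marginal density: its difference quotients are squeezed between two values
    of the conditional distribution function. *)

Section Affine.
Context {R : realType}.
Implicit Types a b c : R.
Local Notation mu := (@lebesgue_measure R).

Lemma measurable_affine a b :
  measurable_fun [set: R] (fun x : R => (a * x + b)%R : R).
Proof. by apply: measurable_funD => //; exact: measurable_funM. Qed.

(** Uniqueness of the Lebesgue measure: the rescaled image measure gives each interval []u, v]] its
    length. *)
Lemma lebesgue_measure_affine a b (A : set R) : a != 0 -> measurable A ->
  mu A = (`|a|%:E * mu [set x | A (a * x + b)%R])%E.
Proof.
move=> a0 mA.
pose T (x : measurableTypeR R) : measurableTypeR R := a * x + b.
have mT : measurable_fun [set: measurableTypeR R] T by exact: measurable_affine.
apply: (@lebesgue_measure_unique R (mscale (NngNum (normr_ge0 a)) (pushforward mu T))) => //.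
move=> _ [[u v]] _ <-.
suff : mu `]u, v] = (`|a|%:E * mu (T @^-1` `]u, v]))%E by [].
(* A negative slope exchanges the end points, so the preimage is closed on the left and open on the
   right. *)
case: (ltP a 0) => ha.
  have -> : T @^-1` `]u, v] = `[(v-b)/a, (u-b)/a[%classic.
    apply/seteqP; split => x /=; rewrite !in_itv/= /T => /andP[h1 h2]; apply/andP; split.
    + by rewrite ler_ndivrMr//; lra.
    + by rewrite ltr_ndivlMr//; lra.
    + by move: h2; rewrite ltr_ndivlMr//; lra.
    + by move: h1; rewrite ler_ndivrMr//; lra.
  rewrite !lebesgue_measure_itv/= !lte_fin ltr_nM2r ?invr_lt0// ltrD2r.
  case: ifP => _; last by rewrite mule0.
  by rewrite -!EFinD -EFinM ltr0_norm//; congr EFin; field.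
have {}ha : 0 < a by rewrite lt_neqAle eq_sym a0.
have -> : T @^-1` `]u, v] = `](u-b)/a, (v-b)/a]%classic.
  apply/seteqP; split => x /=; rewrite !in_itv/= /T => /andP[h1 h2]; apply/andP; split.
  + by rewrite ltr_pdivrMr//; lra.
  + by rewrite ler_pdivlMr//; lra.
  + by move: h1; rewrite ltr_pdivrMr//; lra.
  + by move: h2; rewrite ler_pdivlMr//; lra.
rewrite !lebesgue_measure_itv/= !lte_fin ltr_pM2r ?invr_gt0// ltrD2r.
case: ifP => _; last by rewrite mule0.
by rewrite -!EFinD -EFinM gtr0_norm//; congr EFin; field.
Qed.

Lemma ge0_integral_affine a b (f : R -> \bar R) : a != 0 ->
  measurable_fun [set: R] f -> (forall x, 0 <= f x)%E ->
  (\int[mu]_x f x = `|a|%:E * \int[mu]_x f (a * x + b)%R)%E.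
Proof.
move=> a0 mf f0.
pose T (x : measurableTypeR R) : measurableTypeR R := a * x + b.
have mT : measurable_fun [set: measurableTypeR R] T by exact: measurable_affine.
have := @ge0_integral_pushforward _ _ _ _ R T mT mu setT f measurableT mf (fun x _ => f0 x).
rewrite preimage_setT /comp => <-.
rewrite -(@ge0_integral_mscale _ _ _ _ _ _ (NngNum (normr_ge0 a)))//.
by apply: eq_measure_integral => A mA _; exact: lebesgue_measure_affine.
Qed.

End Affine.

Section Plane.
Context {R : realType}.
Implicit Types a b c : R.
Local Notation mu := (@lebesgue_measure R).
Local Notation mu2 := (mu \x mu)%E.
Implicit Types f : R * R -> \bar R.

Lemma measurable_linear2 a b :
  measurable_fun [set: R * R] (fun z : R * R => (a * z.1 + b * z.2)%R : R).
Proof.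
by apply: measurable_funD; apply: measurable_funM.
Qed.

Lemma measurable_linear_map (a b a' b' : R) : measurable_fun [set: R * R]
  (fun z : R * R => (a * z.1 + b * z.2, a' * z.1 + b' * z.2)).
Proof. by apply: measurable_fun_pair; exact: measurable_linear2. Qed.

Lemma ge0_integral_swap f : measurable_fun setT f -> (forall z, 0 <= f z)%E ->
  (\int[mu2]_z f z = \int[mu2]_z f (z.2, z.1))%E.
Proof.
move=> mf f0.
have mf' : measurable_fun setT (fun z : R * R => f (z.2, z.1)).
  by apply: (measurableT_comp mf); apply: measurable_fun_pair;
    [exact: measurable_snd | exact: measurable_fst].
by rewrite fubini_tonelli2// [RHS]fubini_tonelli1.
Qed.

(** Only one coordinate moves, so by Tonelli this is the one-dimensional change of variables on each
    vertical line. *)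
Lemma ge0_integral_shear a b f : b != 0 ->
  measurable_fun setT f -> (forall z, 0 <= f z)%E ->
  (\int[mu2]_z f z = `|b|%:E * \int[mu2]_z f (z.1, a * z.1 + b * z.2)%R)%E.
Proof.
move=> b0 mf f0.
have mf' : measurable_fun setT (fun z : R * R => f (z.1, a * z.1 + b * z.2)%R).
  apply: (measurableT_comp mf); apply: measurable_fun_pair;
    [exact: measurable_fst | exact: measurable_linear2].
rewrite !fubini_tonelli1// -ge0_integralZl//; last 2 first.
- exact: measurable_fun_fubini_tonelli_F.
- by move=> x _; exact: integral_ge0.
apply: eq_integral => x _; rewrite /fubini_F/=.
rewrite (@ge0_integral_affine _ b (a * x))//; last exact: measurable_fun_pair2.
by under eq_integral do rewrite addrC.
Qed.

Lemma ge0_integral_shear' a b f : a != 0 ->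
  measurable_fun setT f -> (forall z, 0 <= f z)%E ->
  (\int[mu2]_z f z = `|a|%:E * \int[mu2]_z f (a * z.1 + b * z.2, z.2)%R)%E.
Proof.
move=> a0 mf f0.
have msw : measurable_fun setT (fun z : R * R => f (z.2, z.1)).
  by apply: (measurableT_comp mf); apply: measurable_fun_pair;
    [exact: measurable_snd | exact: measurable_fst].
rewrite ge0_integral_swap// (ge0_integral_shear b a0)//=; congr (_ * _)%E.
rewrite ge0_integral_swap//=; first by under eq_integral do rewrite addrC.
apply: (measurableT_comp mf); apply: measurable_fun_pair;
  [exact: measurable_linear2 | exact: measurable_fst].
Qed.

(** For a = cos t and b = sin t, the orthogonal reflection across the line at angle t / 2. *)
Definition reflection a b (z : R * R) : R * R :=
  (a * z.1 + b * z.2, b * z.1 - a * z.2).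

Lemma measurable_reflection a b : measurable_fun setT (reflection a b).
Proof.
rewrite /reflection; under eq_fun do rewrite -mulNr.
exact: measurable_linear_map.
Qed.

(** For a != 0 the reflection is a product of two shears with Jacobians 1 / |a| and |a|. For a = 0
    it is the swap of coordinates up to the sign b. *)
Lemma ge0_integral_reflection a b f : a ^+ 2 + b ^+ 2 = 1 ->
  measurable_fun setT f -> (forall z, 0 <= f z)%E ->
  (\int[mu2]_z f z = \int[mu2]_z f (reflection a b z))%E.
Proof.
move=> ab mf f0; have [a0|a0] := eqVneq a 0.
  have b2 : b ^+ 2 = 1 by rewrite -ab a0 expr0n add0r.
  have nb : `|b| = 1.
    by apply/eqP; rewrite -(@eqrXn2 _ 2)// expr1n -normrX b2 normr1.
  have b0 : b != 0 by rewrite -normr_eq0 nb oner_eq0.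
  rewrite ge0_integral_swap//.
  have msw : measurable_fun setT (fun z : R * R => f (z.2, z.1)).
    by apply: (measurableT_comp mf); apply: measurable_fun_pair;
      [exact: measurable_snd | exact: measurable_fst].
  rewrite (ge0_integral_shear 0 b0)//= nb mul1e.
  rewrite (ge0_integral_shear' 0 b0)//= ?nb ?mul1e.
    apply: eq_integral => z _; rewrite /reflection a0.
    by congr f; congr pair; ring.
  apply: (measurableT_comp mf); apply: measurable_fun_pair;
    [exact: measurable_linear2 | exact: measurable_fst].
have Va0 : - a^-1 != 0 by rewrite oppr_eq0 invr_eq0.
have mL : measurable_fun setT (fun z : R * R => f (z.1, b / a * z.1 + - a^-1 * z.2)%R).
  apply: (measurableT_comp mf); apply: measurable_fun_pair;
    [exact: measurable_fst | exact: measurable_linear2].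
rewrite (ge0_integral_shear (b / a) Va0)// (ge0_integral_shear' b a0)//=.
rewrite muleA -EFinM normrN -normrM mulVf// normr1 mul1e.
apply: eq_integral => z _; rewrite /reflection; congr f; congr pair.
have b2 : b ^+ 2 = 1 - a ^+ 2 by rewrite -ab addrAC subrr add0r.
transitivity ((b ^+ 2 - 1) / a * z.2 + b * z.1); first by field.
by rewrite b2; field.
Qed.

End Plane.

(** * Elliptical laws and spherical symmetry *)

Section EllipticalLaw.
Context {R : realType}.
Local Notation mu := (@lebesgue_measure R).
Local Notation mu2 := (mu \x mu)%E.
Implicit Types (g : R -> R) (rho : R) (P : probability (R * R)%type R).

Definition tilt rho (z : R * R) : R * R :=
  (z.1, rho * z.1 + Num.sqrt (1 - rho ^+ 2) * z.2).

Definition radial g (z : R * R) : R := g (z.1 ^+ 2 + z.2 ^+ 2).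

Lemma onemX2_gt0 rho : -1 < rho < 1 -> 0 < 1 - rho ^+ 2.
Proof. by move=> ?; nra. Qed.

Lemma measurable_tilt rho : measurable_fun setT (tilt rho).
Proof.
by apply: measurable_fun_pair; [exact: measurable_fst|exact: measurable_linear2].
Qed.

(** A generator is measurable on [[0, +oo[] only, so the inner function has to stay in that
    domain. *)
Lemma measurable_generator_comp d (T : measurableType d) g (q : T -> R) :
  density_generator g ->
  measurable_fun setT q -> (forall z, 0 <= q z) -> measurable_fun setT (g \o q).
Proof.
move=> [mg _] mq q0; apply: (measurable_comp _ _ mg) => //.
by move=> _ [z _ <-]; rewrite /= in_itv/= andbT.
Qed.

Lemma measurable_radial g : density_generator g -> measurable_fun setT (radial g).
Proof.
move=> hg; apply: (measurable_generator_comp hg) => [|z].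
  by apply: measurable_funD; apply: measurable_funX.
by rewrite addr_ge0 ?sqr_ge0.
Qed.

Lemma radial_ge0 g z : density_generator g -> 0 <= radial g z.
Proof. by case=> _; apply; rewrite addr_ge0 ?sqr_ge0. Qed.

Lemma elliptical_density_tilt g rho z : -1 < rho < 1 ->
  elliptical_density g rho (tilt rho z) =
  (Num.sqrt (1 - rho ^+ 2))^-1 * radial g z.
Proof.
move=> /onemX2_gt0 r1; rewrite /elliptical_density /radial /tilt/=.
congr (_ * g _); have := sqr_sqrtr (ltW r1).
set s := Num.sqrt _ => s2.
have -> : z.1 ^+ 2 - 2 * rho * z.1 * (rho * z.1 + s * z.2) +
  (rho * z.1 + s * z.2) ^+ 2 = (1 - rho ^+ 2) * z.1 ^+ 2 + s ^+ 2 * z.2 ^+ 2 by ring.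
by rewrite s2 -mulrDr mulrAC divff ?mul1r// gt_eqF.
Qed.

Definition quad_form rho (z : R * R) : R :=
  (z.1 ^+ 2 - 2 * rho * z.1 * z.2 + z.2 ^+ 2) / (1 - rho ^+ 2).

Lemma quad_formE1 rho z : -1 < rho < 1 ->
  quad_form rho z = z.1 ^+ 2 + (z.2 - rho * z.1) ^+ 2 / (1 - rho ^+ 2).
Proof.
by move=> /onemX2_gt0 r1; rewrite /quad_form; field; rewrite gt_eqF.
Qed.

(** Completing the square this way leaves [z.2 ^+ 2] as a lower bound free of [z.1]: it gives the
    majorant of the slices and the positivity off the axis [z.2 = 0]. *)
Lemma quad_formE2 rho z : -1 < rho < 1 ->
  quad_form rho z = z.2 ^+ 2 + (z.1 - rho * z.2) ^+ 2 / (1 - rho ^+ 2).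
Proof.
by move=> /onemX2_gt0 r1; rewrite /quad_form; field; rewrite gt_eqF.
Qed.

Lemma quad_form_ge0 rho z : -1 < rho < 1 -> 0 <= quad_form rho z.
Proof.
move=> r1; rewrite quad_formE1// addr_ge0 ?sqr_ge0// divr_ge0 ?sqr_ge0//.
exact/ltW/onemX2_gt0.
Qed.

Lemma measurable_quad_form rho : measurable_fun setT (quad_form rho).
Proof.
apply: measurable_funM => //; apply: measurable_funD; last exact: measurable_funX.
apply: measurable_funB; first exact: measurable_funX.
by apply: measurable_funM => //; apply: measurable_funM.
Qed.

Lemma measurable_elliptical_density g rho : density_generator g ->
  -1 < rho < 1 -> measurable_fun setT (elliptical_density g rho).
Proof.
move=> hg r1; apply: measurable_funM => //.
apply: (measurable_generator_comp hg); first exact: measurable_quad_form.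
by move=> z; exact: quad_form_ge0.
Qed.

Lemma elliptical_density_ge0 g rho z : density_generator g ->
  -1 < rho < 1 -> 0 <= elliptical_density g rho z.
Proof.
move=> [_ g0] r1; rewrite mulr_ge0 ?invr_ge0 ?sqrtr_ge0//.
exact/g0/quad_form_ge0.
Qed.

(** The tilt is a shear, and its Jacobian cancels the factor (1 - rho^2)^(-1/2) of the density. *)
Lemma elliptical_law_base g rho P : density_generator g -> -1 < rho < 1 ->
  elliptical_law g rho P ->
  exists2 c : R, 0 < c & forall A, measurable A ->
    P A = (c%:E * \int[mu2]_(z in tilt rho @^-1` A) (radial g z)%:E)%E.
Proof.
move=> hg r1 [c c0 hP]; exists c => // A mA.
have s0 : Num.sqrt (1 - rho ^+ 2) != 0.
  by rewrite gt_eqF// sqrtr_gt0 onemX2_gt0.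
have mtA : measurable (tilt rho @^-1` A).
  by rewrite -[X in measurable X]setTI; exact: measurable_tilt.
rewrite hP// integral_mkcond.
have md := measurable_elliptical_density hg r1.
have mcd : measurable_fun setT
    (fun z => (c * elliptical_density g rho z)%:E).
  by apply/measurable_EFinP; exact: measurable_funM.
have mh : measurable_fun setT ((fun z => (c * elliptical_density g rho z)%:E) \_ A).
  by apply/(measurable_restrictT _ _).1 => //; exact: measurable_funTS.
rewrite (ge0_integral_shear rho s0); last 2 first.
- exact: mh.
- move=> z; rewrite patchE; case: ifP => // _.
  by rewrite lee_fin mulr_ge0 ?(ltW c0)// elliptical_density_ge0.
rewrite [in RHS]integral_mkcond.
have mr : measurable_fun setT ((EFin \o radial g) \_ (tilt rho @^-1` A)).
  apply/(measurable_restrictT _ _).1 => //; apply: measurable_funTS.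
  by apply/measurable_EFinP; exact: measurable_radial.
rewrite -[LHS]ge0_integralZl//; last 2 first.
- exact: (measurableT_comp mh (measurable_tilt rho)).
- move=> z _; rewrite patchE; case: ifP => // _.
  by rewrite lee_fin mulr_ge0 ?(ltW c0)// elliptical_density_ge0.
rewrite -[RHS]ge0_integralZl//; last 2 first.
- by move=> z _; rewrite patchE; case: ifP => // _; rewrite lee_fin radial_ge0.
- by rewrite lee_fin ltW.
apply: eq_integral => z _; rewrite !patchE -/(tilt rho z).
have -> : (tilt rho z \in A) = (z \in tilt rho @^-1` A) by apply/idP/idP; rewrite !inE.
case: ifP => _; last by rewrite !mule0.
rewrite elliptical_density_tilt//= -!EFinM ger0_norm ?sqrtr_ge0//; congr EFin.
by field.
Qed.

End EllipticalLaw.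

Section SphericalLaw.
Context {R : realType}.
Local Notation mu := (@lebesgue_measure R).
Local Notation mu2 := (mu \x mu)%E.
Implicit Types (g : R -> R) (rho : R) (P : probability (R * R)%type R).
Implicit Types (A : set (R * R)).

Lemma tilt0 (z : R * R) : tilt 0 z = z.
Proof.
by case: z => x y; rewrite /tilt/= expr0n subr0 sqrtr1 mul0r add0r mul1r.
Qed.

Lemma spherical_law_radial g P : density_generator g -> elliptical_law g 0 P ->
  exists2 c : R, 0 < c & forall A, measurable A ->
    P A = (c%:E * \int[mu2]_(z in A) (radial g z)%:E)%E.
Proof.
move=> hg hP; have [|c c0 E] := elliptical_law_base hg _ hP; first by lra.
by exists c => // A mA; rewrite E//; have -> : tilt 0 @^-1` A = A
  by apply/seteqP; split => z /=; rewrite tilt0.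
Qed.

Lemma measurable_preimage_reflection (a b : R) A : measurable A ->
  measurable (reflection a b @^-1` A).
Proof.
move=> mA; rewrite -[X in measurable X]setTI.
by have := @measurable_reflection R a b; exact.
Qed.

Lemma measurable_preimage_tilt rho A : measurable A ->
  measurable (tilt rho @^-1` A).
Proof.
move=> mA; rewrite -[X in measurable X]setTI.
by have := @measurable_tilt R rho; exact.
Qed.

Lemma spherical_law_reflection g P (a b : R) A : density_generator g ->
  elliptical_law g 0 P -> a ^+ 2 + b ^+ 2 = 1 -> measurable A ->
  P (reflection a b @^-1` A) = P A.
Proof.
move=> hg hP ab mA; have [c c0 E] := spherical_law_radial hg hP.
rewrite !E//; last exact: measurable_preimage_reflection.
congr (_ * _)%E; rewrite [RHS]integral_mkcond [LHS]integral_mkcond.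
rewrite [RHS](ge0_integral_reflection ab); last 2 first.
- apply/(measurable_restrictT _ _).1 => //; apply: measurable_funTS.
  by apply/measurable_EFinP; exact: measurable_radial.
- by move=> z; rewrite patchE; case: ifP => // _; rewrite lee_fin radial_ge0.
apply: eq_integral => z _; rewrite !patchE.
have -> : (z \in reflection a b @^-1` A) = (reflection a b z \in A).
  by apply/idP/idP; rewrite !inE.
case: ifP => // _; congr (EFin (g _)); rewrite /reflection/=.
transitivity ((a ^+ 2 + b ^+ 2) * (z.1 ^+ 2 + z.2 ^+ 2)); first by rewrite ab mul1r.
by ring.
Qed.

Lemma elliptical_law_tilt g rho P P0 A : density_generator g ->
  -1 < rho < 1 -> elliptical_law g rho P -> elliptical_law g 0 P0 ->
  measurable A -> P A = P0 (tilt rho @^-1` A).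
Proof.
move=> hg r1 hP hP0 mA.
have [c c0 E] := elliptical_law_base hg r1 hP.
have [c' c'0 E'] := spherical_law_radial hg hP0.
(* Each constant times the total mass of [radial g] is 1; hence that mass is finite and nonzero, and
   the constants agree. *)
suff cc : c = c' by rewrite E// E' ?cc//; exact: measurable_preimage_tilt.
have := E setT measurableT; rewrite preimage_setT probability_setT.
have := E' setT measurableT; rewrite probability_setT.
case: (\int[_]_(_ in _) _)%E => [r|h|]; last 2 first.
- by move: h; rewrite gt0_muley ?lte_fin.
- by rewrite gt0_muleNy ?lte_fin.
rewrite -!EFinM => -[h'] -[h].
have r0 : r != 0 by apply/eqP => r0; move: h; rewrite r0; lra.
by apply: (mulIf r0); rewrite -h -h'.
Qed.

Lemma spherical_law_line0 g P (x : R) : density_generator g ->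
  elliptical_law g 0 P -> P [set z | z.1 = x] = 0%E.
Proof.
move=> hg hP; have [c c0 E] := spherical_law_radial hg hP.
have mL : measurable [set z : R * R | z.1 = x].
  by have := @measurable_fst _ _ R R measurableT [set x] (measurable_set1 x);
    rewrite setTI.
rewrite E// (_ : \int[_]_(_ in _) _ = 0)%E ?mule0//.
rewrite integral_mkcond fubini_tonelli2; last 2 first.
- apply/(measurable_restrictT _ _).1 => //; apply: measurable_funTS.
  by apply/measurable_EFinP; exact: measurable_radial.
- by move=> z; rewrite patchE; case: ifP => // _; rewrite lee_fin radial_ge0.
apply: integral0_eq => y _; rewrite /fubini_G.
transitivity (\int[mu]_(u in [set x]) (radial g (u, y))%:E)%E.
  rewrite [RHS]integral_mkcond; apply: eq_integral => u _; rewrite !patchE.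
  by congr (if _ then _ else _); apply/idP/idP; rewrite !inE.
by rewrite integral_set1.
Qed.

End SphericalLaw.

(** * Positive mass of sectors *)

Section Sectors.
Context {R : realType}.
Local Notation mu := (@lebesgue_measure R).
Local Notation mu2 := (mu \x mu)%E.
Implicit Types (g : R -> R) (rho : R) (P : probability (R * R)%type R).
Implicit Types (A : set (R * R)) (T : set R).

(** The left half-plane is chosen because the quadrants compared at the origin lie in [z.1 <= 0]. *)
Definition slopes T : set (R * R) := [set z | z.1 < 0 /\ T (z.2 / z.1)].

(** Inversion is continuous off 0, and the convention that [0^-1] is 0 makes it an extension by
    zero. *)
Lemma measurable_inv : measurable_fun [set: R] (fun x : R => x^-1).
Proof.
have -> : (fun x : R => x^-1) = patch (fun=> 0) [set~ 0] (fun x : R => x^-1).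
  apply/funext => x; rewrite patchE; case: ifPn => //.
  by rewrite notin_setE/= => /contrapT ->; rewrite invr0.
apply/(measurable_restrictT _ _).1; first exact: measurableC.
apply: open_continuous_measurable_fun; first by rewrite openC; exact: closed_eq.
by move=> x; rewrite inE => /eqP x0; exact: inv_continuous.
Qed.

Lemma measurable_slopes T : measurable T -> measurable (slopes T).
Proof.
move=> mT; apply: measurableI.
  have := @measurable_fst _ _ R R measurableT _ (measurable_itv `]-oo, 0[).
  by rewrite setTI; congr measurable; apply/seteqP; split => z /=; rewrite in_itv.
have mq : measurable_fun [set: R * R] (fun z : R * R => z.2 / z.1).
  apply: measurable_funM => //.
  exact: (measurableT_comp measurable_inv measurable_fst).
have := mq measurableT T mT.
by rewrite setTI.
Qed.

(** A substitute for polar coordinates: the slope t = z.2 / z.1 and a rescaled abscissa separate the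
    variables, so all sectors share the same radial factor. *)
Lemma integral_radial_slopes g T : density_generator g -> measurable T ->
  (\int[mu2]_(z in slopes T) (radial g z)%:E =
   \int[mu]_(t in T) ((1 + t ^+ 2)^-1)%:E *
   \int[mu]_(x in `]-oo, 0%R[) (- x * g (x ^+ 2))%:E)%E.
Proof.
move=> hg mT; have g0 := hg.2.
pose k x := if x < 0 then - x * g (x ^+ 2) else 0.
have mk : measurable_fun setT k.
  apply: measurable_fun_ifT => //; first exact: measurable_fun_ltr.
  apply: measurable_funM => //.
  apply: (measurable_generator_comp hg); first exact: measurable_funX.
  by move=> x; exact: sqr_ge0.
have k0 x : 0 <= k x.
  by rewrite /k; case: ltP => // x0; rewrite mulr_ge0 ?g0 ?sqr_ge0// oppr_ge0 ltW.
have -> : (\int[mu]_(x in `]-oo, 0%R[) (- x * g (x ^+ 2))%:E = \int[mu]_x (k x)%:E)%E.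
  rewrite integral_mkcond; apply: eq_integral => x _.
  by rewrite patchE /k mem_setE in_itv/=; case: ifP.
set I := (\int[mu]_x (k x)%:E)%E.
have I0 : (0 <= I)%E by apply: integral_ge0 => x _; rewrite lee_fin.
pose d t : R := 1 + t ^+ 2.
have d0 t : 0 < d t by rewrite ltr_pwDl// sqr_ge0.
(* The integrand in the coordinates x and t = y / x: on x < 0, [k (x * sqrt d) / sqrt d] is -x g(x^2
   (1 + t^2)), with the Jacobian |x| included. *)
pose F (z : R * R) : \bar R :=
  (\1_T z.2 * (Num.sqrt (d z.2))^-1 * k (z.1 * Num.sqrt (d z.2)))%:E.
have md : measurable_fun setT (fun z : R * R => Num.sqrt (d z.2)).
  have ms : measurable_fun setT (Num.sqrt : R -> R).
    by apply: continuous_measurable_fun; exact: sqrt_continuous.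
  apply: (measurableT_comp ms); apply: measurable_funD => //.
  exact: measurable_funX.
have mF : measurable_fun setT F.
  apply/measurable_EFinP; apply: measurable_funM.
    apply: measurable_funM => //.
      exact: (measurableT_comp (measurable_indic mT) measurable_snd).
    exact: (measurableT_comp measurable_inv md).
  apply: measurableT_comp => //.
  by apply: measurable_funM.
have F0 z : (0 <= F z)%E.
  by rewrite lee_fin !mulr_ge0 ?invr_ge0 ?sqrtr_ge0.
have mrad : measurable_fun setT ((EFin \o radial g) \_ (slopes T)).
  apply/(measurable_restrictT _ _).1; first exact: measurable_slopes.
  by apply: measurable_funTS; apply/measurable_EFinP; exact: measurable_radial.
rewrite integral_mkcond fubini_tonelli1; last 2 first.
- exact: mrad.
- by move=> z; rewrite patchE; case: ifP => // _; rewrite lee_fin radial_ge0.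
transitivity (\int[mu]_x \int[mu]_t F (x, t))%E.
  apply: eq_integral => x _; rewrite /fubini_F.
  have [x0|x0] := ltP x 0; last first.
    rewrite !integral0_eq// => y _; last first.
      rewrite patchE; case: ifPn => //; rewrite inE => -[/=].
      by rewrite ltNge x0.
    by rewrite /F/= /k [_ < 0]ltNge mulr_ge0 ?sqrtr_ge0//= mulr0.
  have xN0 : x != 0 by rewrite lt_eqF.
  (* Substitution y = x t at fixed x. *)
  rewrite [LHS](ge0_integral_affine 0 xN0); last 2 first.
  + exact: (measurable_fun_pair2 x mrad).
  + by move=> t; rewrite /= patchE; case: ifP => // _; rewrite lee_fin radial_ge0.
  rewrite -ge0_integralZl//; last 2 first.
  + exact: (measurableT_comp (measurable_fun_pair2 x mrad) (measurable_affine x 0)).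
  + by move=> t _; rewrite /= patchE; case: ifP => // _; rewrite lee_fin radial_ge0.
  apply: eq_integral => t _; rewrite addr0 patchE /F/=.
  rewrite /k pmulr_llt0 ?sqrtr_gt0// x0.
  have [h|h] := pselect (slopes T (x, x * t)).
    rewrite mem_set//; have -> : \1_T t = 1 :> R.
      by rewrite indicE mem_set//; case: h => _ /=; rewrite mulrAC divff// mul1r.
    rewrite -EFinM; congr EFin; rewrite ltr0_norm// /radial/= mul1r.
    have sN0 : Num.sqrt (d t) != 0 by rewrite gt_eqF// sqrtr_gt0.
    have -> : x ^+ 2 + (x * t) ^+ 2 = (x * Num.sqrt (d t)) ^+ 2.
      by rewrite [RHS]exprMn sqr_sqrtr ?ltW// /d; ring.
    by field.
  rewrite memNset// indicE memNset ?mul0r ?mule0// => Tt; apply: h; split => //=.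
  by rewrite mulrAC divff// mul1r.
rewrite fubini_tonelli//.
transitivity (\int[mu]_t ((\1_T t * (d t)^-1)%:E * I))%E; last first.
  rewrite ge0_integralZr//.
  - congr (_ * _)%E; rewrite [RHS]integral_mkcond; apply: eq_integral => t _.
    rewrite patchE indicE; case: (t \in T); by rewrite ?mul1r ?mul0r.
  - apply/measurable_EFinP; apply: measurable_funM.
      exact: measurable_indic.
    by apply: (measurableT_comp measurable_inv); apply: measurable_funD.
  - by move=> t _; rewrite lee_fin mulr_ge0// invr_ge0 ltW.
apply: eq_integral => t _.
have sN0 : Num.sqrt (d t) != 0 by rewrite gt_eqF// sqrtr_gt0.
(* Rescaling x by [sqrt (d t)] produces the second factor [1 / sqrt (d t)], hence the weight 1 / (1
   + t^2). *)
rewrite /I (ge0_integral_affine 0 sN0); last 2 first.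
- exact/measurable_EFinP.
- by move=> x; rewrite lee_fin.
rewrite muleA -EFinM -ge0_integralZl//; last 3 first.
- apply/measurable_EFinP; apply: (measurableT_comp mk).
  exact: measurable_affine.
- by move=> x _; rewrite lee_fin.
- by rewrite lee_fin !mulr_ge0// ?invr_ge0 ltW.
apply: eq_integral => x _; rewrite /F/= -EFinM addr0 [_ * x]mulrC; congr EFin.
rewrite -[X in (_ * X^-1 * _ * _)]sqr_sqrtr ?ltW// ger0_norm ?sqrtr_ge0//.
by field.
Qed.

Lemma integral_cauchy_gt0 (m m' : R) : m < m' ->
  (0 < \int[mu]_(t in `]m, m'[) ((1 + t ^+ 2)^-1)%:E)%E.
Proof.
move=> mm'; pose k : R := (1 + m ^+ 2 + m' ^+ 2)^-1.
have k0 : 0 < k by rewrite invr_gt0; nra.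
apply: (@lt_le_trans _ _ (\int[mu]_(t in `]m, m'[) cst k%:E t)%E).
  rewrite integral_cst//= lebesgue_measure_itv/= lte_fin mm' -EFinD -EFinM.
  by rewrite lte_fin mulr_gt0// subr_gt0.
apply: ge0_le_integral => //=.
- by move=> t _; rewrite lee_fin ltW.
- apply/measurable_EFinP; apply: measurable_funTS.
  by apply: (measurableT_comp measurable_inv); apply: measurable_funD.
- move=> t; rewrite in_itv/= => /andP[mt tm']; rewrite lee_fin /k.
  rewrite lef_pV2 ?posrE; [|nra|nra].
  by have [t0|t0] := leP 0 t; nra.
Qed.

(** Otherwise the opposite half-plane would be null by reflection, the axis between them is null,
    and the total mass would be 0. *)
Lemma spherical_law_halfplane_gt0 g P : density_generator g ->
  elliptical_law g 0 P -> (0 < P [set z | (z.1 < 0)%R])%E.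
Proof.
move=> hg hP; rewrite lt0e measure_ge0 andbT; apply/eqP => P0.
have mN : measurable [set z : R * R | z.1 < 0].
  have := @measurable_fst _ _ R R measurableT _ (measurable_itv `]-oo, 0[).
  by rewrite setTI; congr measurable; apply/seteqP; split => z /=; rewrite in_itv.
have mL : measurable [set z : R * R | z.1 = 0].
  by have := @measurable_fst _ _ R R measurableT [set 0] (measurable_set1 0);
    rewrite setTI.
have ab : (-1 : R) ^+ 2 + 0 ^+ 2 = 1 by rewrite sqrrN expr1n expr0n addr0.
have P0' := spherical_law_reflection hg hP ab mN.
have mN' := measurable_preimage_reflection (-1) 0 mN.
have : (P [set: R * R] <= 0)%E.
  rewrite (_ : setT = [set z : R * R | z.1 < 0] `|`
     (reflection (-1) 0 @^-1` [set z : R * R | z.1 < 0] `|` [set z | z.1 = 0])).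
    apply: (le_trans (measureU2 _ _ _)) => //; first exact: measurableU.
    rewrite [X in (X + _)%E]P0 add0e; apply: (le_trans (measureU2 _ _ _)) => //.
    by rewrite [X in (X + _)%E]P0' P0 add0e [leLHS](spherical_law_line0 0 hg hP).
  apply/seteqP; split => // z _; rewrite /reflection/= mul0r addr0 mulN1r oppr_lt0.
  by case: (ltgtP z.1 0) => h; [left|right; left|right; right].
by rewrite probability_setT lee_fin ler10.
Qed.

(** The half-plane is the sector of all slopes; its positive mass shows that the common radial
    factor does not vanish. As [z.1 < 0], dividing by it reverses the inequalities. *)
Lemma spherical_law_sector_gt0 g P (m m' : R) : density_generator g ->
  elliptical_law g 0 P -> m < m' ->
  (0 < P [set z | [/\ z.1 < 0, m' * z.1 < z.2 & z.2 < m * z.1]%R])%E.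
Proof.
move=> hg hP mm'; have [c c0 E] := spherical_law_radial hg hP.
have -> : [set z | [/\ z.1 < 0, m' * z.1 < z.2 & z.2 < m * z.1]%R] =
    slopes `]m, m'[.
  apply/seteqP; split => z; rewrite /slopes /= in_itv/=.
    by case=> z0 h1 h2; rewrite ltr_ndivlMr// ltr_ndivrMr// h1 h2.
  by case=> z0; rewrite ltr_ndivlMr// ltr_ndivrMr// => /andP[h1 h2]; split.
rewrite E; last exact: measurable_slopes.
rewrite integral_radial_slopes//.
have := spherical_law_halfplane_gt0 hg hP.
have -> : [set z : R * R | (z.1 < 0)%R] = slopes setT.
  by apply/seteqP; split => z /= [].
rewrite E; last exact: measurable_slopes.
rewrite integral_radial_slopes//.
set I := (\int[mu]_(x in `]-oo, _[) _)%E.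
have [->|I0 _] := eqVneq I 0%E; first by rewrite !mule0 ltxx.
rewrite !mule_gt0 ?lte_fin ?integral_cauchy_gt0// lt0e I0/=.
apply: integral_ge0 => x; rewrite /= in_itv/= => x0.
by rewrite lee_fin mulr_ge0 ?hg.2 ?sqr_ge0// oppr_ge0 ltW.
Qed.

End Sectors.

(** * Monotonicity in the correlation *)

Section SphericalCdf.
Context {R : realType}.
Implicit Types (g : R -> R) (rho x y : R) (P : probability (R * R)%type R).

Local Notation sq rho := (Num.sqrt (1 - rho ^+ 2)).

Definition axis_cdf P x : R := fine (P [set z | z.1 <= x]).

Definition tilted_cdf P rho x y : R :=
  fine (P [set z | z.1 <= x /\ (tilt rho z).2 <= y]).

Lemma measurable_halfplane (a b x : R) :
  measurable [set z : R * R | a * z.1 + b * z.2 <= x].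
Proof.
have := @measurable_linear2 R a b measurableT _ (measurable_itv `]-oo, x]).
by rewrite setTI; congr measurable; apply/seteqP; split => z /=; rewrite in_itv.
Qed.

Lemma measurable_axis_halfplane x : measurable [set z : R * R | z.1 <= x].
Proof.
have := measurable_halfplane 1 0 x; congr measurable.
by apply/seteqP; split => z /=; rewrite mul1r mul0r addr0.
Qed.

Lemma measurable_tilted_quadrant rho x y :
  measurable [set z : R * R | z.1 <= x /\ (tilt rho z).2 <= y].
Proof.
by apply: measurableI; [exact: measurable_axis_halfplane|exact: measurable_halfplane].
Qed.

Lemma sqrt_onemX2_gt0 rho : -1 < rho < 1 -> 0 < sq rho.
Proof. by move=> r1; rewrite sqrtr_gt0 onemX2_gt0. Qed.

Lemma sqr_sqrt_onemX2 rho : -1 < rho < 1 -> sq rho ^+ 2 = 1 - rho ^+ 2.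
Proof. by move=> r1; rewrite sqr_sqrtr// ltW// onemX2_gt0. Qed.

(* Two-point symmetrization: the reflection exchanging the unit vectors at
   angles arccos rho and arccos rho' moves the points of the quadrant for rho
   outside the quadrant for rho' into the latter. *)
Lemma tilted_cdf_le g P rho rho' x y : density_generator g ->
  elliptical_law g 0 P -> -1 < rho < 1 -> -1 < rho' < 1 -> rho <= rho' ->
  tilted_cdf P rho x y <= tilted_cdf P rho' x y.
Proof.
move=> hg hP r1 r1'; rewrite le_eqVlt => /predU1P[->//|rr'].
have := sqrt_onemX2_gt0 r1; have := sqr_sqrt_onemX2 r1.
have := sqrt_onemX2_gt0 r1'; have := sqr_sqrt_onemX2 r1'.
rewrite /tilted_cdf /tilt/=; set s := sq rho; set s' := sq rho' => s'2 s'0 s2 s0.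
(* Cosine and sine of the sum of the two angles: the axis of the reflection bisects the two unit
   vectors. *)
pose a := rho * rho' - s * s'; pose b := rho * s' + s * rho'.
have ab : a ^+ 2 + b ^+ 2 = 1.
  transitivity ((rho ^+ 2 + s ^+ 2) * (rho' ^+ 2 + s' ^+ 2)); first by rewrite /a /b; ring.
  by rewrite s2 s'2; ring.
pose A := [set z : R * R | z.1 <= x].
pose B := [set z : R * R | rho * z.1 + s * z.2 <= y].
pose B' := [set z : R * R | rho' * z.1 + s' * z.2 <= y].
have mA : measurable A by exact: measurable_axis_halfplane.
have mB : measurable B by exact: measurable_halfplane.
have mB' : measurable B' by exact: measurable_halfplane.
rewrite -[X in fine (P X) <= _]/(A `&` B) -[X in _ <= fine (P X)]/(A `&` B').
have mAB : measurable (A `&` B) by exact: measurableI.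
have mAB' : measurable (A `&` B') by exact: measurableI.
apply: fine_le; [exact: fin_num_measure|exact: fin_num_measure|].
(* The intersection of both quadrants is common, so only the two set differences are compared. *)
rewrite (measureDI P mAB mB') [leRHS](measureDI P mAB' mB).
rewrite (setIAC A B) leeD2r//.
have mD1 : measurable (A `&` B `\` B') by exact: measurableD.
have mD2 : measurable (A `&` B' `\` B) by exact: measurableD.
apply: (@le_trans _ _ (P (reflection a b @^-1` (A `&` B `\` B')))).
  by rewrite (spherical_law_reflection hg hP ab mD1).
apply: le_measure; rewrite ?inE//; first exact: measurable_preimage_reflection.
move=> z; rewrite /reflection /A /B /B' /=.
have e1 : rho * (a * z.1 + b * z.2) + s * (b * z.1 - a * z.2) =
          rho' * z.1 + s' * z.2.
  transitivity ((rho ^+ 2 + s ^+ 2) * (rho' * z.1 + s' * z.2)); first by rewrite /a /b; ring.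
  by rewrite s2 subrKC mul1r.
have e2 : rho' * (a * z.1 + b * z.2) + s' * (b * z.1 - a * z.2) =
          rho * z.1 + s * z.2.
  transitivity ((rho' ^+ 2 + s' ^+ 2) * (rho * z.1 + s * z.2)); first by rewrite /a /b; ring.
  by rewrite s'2 subrKC mul1r.
rewrite e1 e2 => -[[h1 h2] /negP]; rewrite -ltNge => h3.
split; last by apply/negP; rewrite -ltNge.
split => //; apply: le_trans h1; rewrite -subr_ge0.
(* The reflection moves points along the difference of the two unit vectors, so the change of [z.1]
   is a positive multiple of the difference of the two projections. [D0] concerns 1 minus the cosine
   of the angle between the vectors. *)
have N0 : 0 < 1 - rho * rho' + s * s' by nra.
have eN : (1 - rho * rho' + s * s') * (1 - (rho * rho' + s * s')) = (rho' - rho) ^+ 2.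
  transitivity ((1 - rho * rho') ^+ 2 - s ^+ 2 * s' ^+ 2); first by ring.
  by rewrite s2 s'2; ring.
have D0 : 0 < 1 - (rho * rho' + s * s').
  by rewrite -(pmulr_rgt0 _ N0) eN exprn_gt0// subr_gt0.
rewrite -(pmulr_rge0 _ D0).
suff -> : (1 - (rho * rho' + s * s')) * (a * z.1 + b * z.2 - z.1) =
    (rho' - rho) * ((rho * z.1 + s * z.2) - (rho' * z.1 + s' * z.2)).
  by rewrite mulr_ge0// subr_ge0 ltW//; exact: le_lt_trans h3.
transitivity (- ((1 - rho * rho' + s * s') * (1 - (rho * rho' + s * s'))) * z.1
   + (b - (rho ^+ 2 * rho' * s' + rho * s * rho' ^+ 2
           + rho * s * s' ^+ 2 + rho' * s' * s ^+ 2)) * z.2).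
  by rewrite /a /b; ring.
by rewrite eN s2 s'2 /b; ring.
Qed.

(** At the origin the quadrant for rho is bounded by the line of slope -rho / sqrt (1 - rho^2),
    which decreases in rho; the quadrant for rho' gains the sector between the two lines. *)
Lemma tilted_cdf_lt00 g P rho rho' : density_generator g ->
  elliptical_law g 0 P -> -1 < rho < 1 -> -1 < rho' < 1 -> rho < rho' ->
  tilted_cdf P rho 0 0 < tilted_cdf P rho' 0 0.
Proof.
move=> hg hP r1 r1' rr'.
have := sqrt_onemX2_gt0 r1; have := sqr_sqrt_onemX2 r1.
have := sqrt_onemX2_gt0 r1'; have := sqr_sqrt_onemX2 r1'.
rewrite /tilted_cdf /tilt/=; set s := sq rho; set s' := sq rho' => s'2 s'0 s2 s0.
have mm' : - (rho' / s') < - (rho / s).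
  rewrite ltrN2 ltr_pdivrMr// mulrAC ltr_pdivlMr//.
  (* Multiplying by the conjugate removes the square roots; when the two correlations have opposite
     signs the claim is immediate. *)
  have ss : (rho' * s - rho * s') * (rho' * s + rho * s') = (rho' - rho) * (rho' + rho).
    transitivity (rho' ^+ 2 * s ^+ 2 - rho ^+ 2 * s' ^+ 2); first by ring.
    by rewrite s2 s'2; ring.
  rewrite -subr_gt0; have [h|h] := leP 0 rho.
    have Y0 : 0 < rho' * s + rho * s' by nra.
    by rewrite -(pmulr_lgt0 _ Y0) ss mulr_gt0//; lra.
  have [h'|h'] := leP 0 rho'; first by nra.
  have Y0 : rho' * s + rho * s' < 0 by nra.
  by rewrite -(nmulr_llt0 _ Y0) ss pmulr_rlt0//; lra.
pose S := [set z : R * R |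
  [/\ z.1 < 0, - (rho / s) * z.1 < z.2 & z.2 < - (rho' / s') * z.1]%R].
have mS : measurable S.
  have := measurableI _ _ (measurable_slopes (measurable_itv `]-oo, - (rho / s)[))
    (measurable_slopes (measurable_itv `]- (rho' / s'), +oo[)).
  congr measurable; apply/seteqP; split => z; rewrite /S /slopes/= !in_itv/= andbT.
    by move=> [[z0 h1] [_ h2]]; move: h1 h2; rewrite ltr_ndivlMr// ltr_ndivrMr.
  by case=> z0 h1 h2; rewrite ltr_ndivlMr// ltr_ndivrMr.
pose Q := [set z : R * R | z.1 <= 0 /\ rho * z.1 + s * z.2 <= 0].
have mQ : measurable Q := measurable_tilted_quadrant rho 0 0.
have mQ' := measurable_tilted_quadrant rho' 0 0.
rewrite -lte_fin !fineK ?fin_num_measure//.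
have S0 : (0 < P S)%E by exact: spherical_law_sector_gt0 hg hP mm'.
apply: (@lt_le_trans _ _ (P Q + P S)%E).
  by rewrite lteDl ?fin_num_measure.
rewrite -measureU//.
  apply: le_measure; rewrite ?inE//; first exact: measurableU.
  move=> z /= [[z0 h]|[z0 h1 h2]].
    split => //.
    have h' : z.2 <= - (rho / s) * z.1.
      rewrite -(ler_pM2l s0); move: h.
      by rewrite mulNr mulrN mulrA [s * (_ / _)]mulrCA divff ?gt_eqF// mulr1; lra.
    have : z.2 <= - (rho' / s') * z.1 by nra.
    rewrite -(ler_pM2l s'0) mulNr mulrN mulrA [s' * (_ / _)]mulrCA divff ?gt_eqF// mulr1; lra.
  split; first exact: ltW.
  move: h2; rewrite -(ltr_pM2l s'0) mulNr mulrN mulrA [s' * (_ / _)]mulrCA.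
  by rewrite divff ?gt_eqF// mulr1; lra.
apply/seteqP; split => // z /= [[z0 h]] [_ h1 _].
move: h1; rewrite -(ltr_pM2l s0) mulNr mulrN mulrA [s * (_ / _)]mulrCA.
by rewrite divff ?gt_eqF// mulr1; lra.
Qed.

End SphericalCdf.

(** * Symmetries and continuity of the distribution functions *)

Section SphericalCdfSymmetries.
Context {R : realType}.
Implicit Types (g : R -> R) (rho x y : R) (P : probability (R * R)%type R).

Local Notation sq rho := (Num.sqrt (1 - rho ^+ 2)).

Lemma sqr_rho_sq rho : -1 < rho < 1 -> rho ^+ 2 + sq rho ^+ 2 = 1.
Proof. by move=> r1; rewrite sqr_sqrt_onemX2// subrKC. Qed.

(** This reflection exchanges the two unit vectors that define the pair, whence equal marginals and
    a symmetric joint distribution function. *)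
Lemma tilt_reflection2 rho z : -1 < rho < 1 ->
  (tilt rho (reflection rho (sq rho) z)).2 = z.1.
Proof.
move=> r1; rewrite /tilt /reflection/=.
transitivity ((rho ^+ 2 + sq rho ^+ 2) * z.1); first by ring.
by rewrite sqr_rho_sq// mul1r.
Qed.

Lemma spherical_law_tilt_marginal g P rho y : density_generator g ->
  elliptical_law g 0 P -> -1 < rho < 1 ->
  P [set z | (tilt rho z).2 <= y] = P [set z | z.1 <= y].
Proof.
move=> hg hP r1.
have mT : measurable [set z | (tilt rho z).2 <= y] by exact: measurable_halfplane.
rewrite -(spherical_law_reflection hg hP (sqr_rho_sq r1) mT).
by congr (P _); apply/funext => z; rewrite /preimage /mkset tilt_reflection2.
Qed.

Lemma tilted_cdfC g P rho x y : density_generator g ->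
  elliptical_law g 0 P -> -1 < rho < 1 ->
  tilted_cdf P rho x y = tilted_cdf P rho y x.
Proof.
move=> hg hP r1; rewrite /tilted_cdf.
rewrite -(spherical_law_reflection hg hP (sqr_rho_sq r1));
  last exact: measurable_tilted_quadrant.
congr (fine (P _)); apply/seteqP.
split => z [h1 h2]; split; [|exact: h1|exact: h2|].
  by rewrite -(tilt_reflection2 z r1); exact: h2.
by move: h1; rewrite -(tilt_reflection2 z r1).
Qed.

Lemma axis_cdfN g P x : density_generator g -> elliptical_law g 0 P ->
  axis_cdf P (- x) = 1 - axis_cdf P x.
Proof.
move=> hg hP; rewrite /axis_cdf.
have ab : (-1 : R) ^+ 2 + 0 ^+ 2 = 1 by rewrite sqrrN expr1n expr0n addr0.
have mx := @measurable_axis_halfplane R.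
have mL : measurable [set z : R * R | z.1 = x].
  by have := @measurable_fst _ _ R R measurableT [set x] (measurable_set1 x);
    rewrite setTI.
rewrite -(spherical_law_reflection hg hP ab (mx _)).
have -> : reflection (-1) 0 @^-1` [set z | z.1 <= - x] =
    ~` [set z | z.1 <= x] `|` [set z | z.1 = x].
  apply/seteqP; split => z; rewrite /reflection/= mul0r addr0 mulN1r lerN2.
    by rewrite le_eqVlt => /predU1P[->|h]; [right|left; apply/negP; rewrite -ltNge].
  by case=> [/negP|->//]; rewrite -ltNge => /ltW.
rewrite measureU//; last 2 first.
- exact: measurableC.
- apply/seteqP; split => // z /= [/negP]; rewrite -ltNge => h zx.
  by move: h; rewrite zx ltxx.
rewrite [X in (_ + X)%E](spherical_law_line0 x hg hP) adde0.
transitivity (fine (1 - P [set z | (z.1 <= x)%R])%E).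
  by congr fine; exact: (probability_setC P (mx x)).
by rewrite fineB// ?fin_num_measure.
Qed.

(** Changing the sign of [z.1] turns the tilt by -rho into the tilt by rho and [z.1 <= x] into
    [z.1 >= - x]; the boundary line is null. *)
Lemma tilted_cdfN g P rho x y : density_generator g ->
  elliptical_law g 0 P -> -1 < rho < 1 ->
  tilted_cdf P (- rho) x y = axis_cdf P y - tilted_cdf P rho (- x) y.
Proof.
move=> hg hP r1; rewrite /axis_cdf /tilted_cdf.
have ab : (-1 : R) ^+ 2 + 0 ^+ 2 = 1 by rewrite sqrrN expr1n expr0n addr0.
have mx := @measurable_axis_halfplane R.
have mL : measurable [set z : R * R | z.1 = - x].
  by have := @measurable_fst _ _ R R measurableT [set - x] (measurable_set1 _);
    rewrite setTI.
have mT : measurable [set z | (tilt rho z).2 <= y] by exact: measurable_halfplane.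
rewrite -(spherical_law_tilt_marginal _ hg hP r1).
have mQ := measurable_tilted_quadrant rho (- x) y.
pose B : set (R * R) := [set z | (tilt rho z).2 <= y].
pose L : set (R * R) := [set z | z.1 <= - x].
pose L0 : set (R * R) := [set z | z.1 = - x].
have mD : measurable (B `\` L) by exact: (measurableD mT (mx (- x))).
have mI : measurable (B `&` L0) by exact: (measurableI _ _ mT mL).
have PB : P B = (P (B `\` L) + P [set z | (z.1 <= - x)%R /\ ((tilt rho z).2 <= y)%R])%E.
  rewrite (measureDI P mT (mx (- x))); congr (_ + P _)%E.
  by apply/seteqP; split => z [].
rewrite -[P [set z | (tilt rho z).2 <= y]]/(P B) -fineB ?fin_num_measure//.
rewrite PB addeK ?fin_num_measure//; congr fine.
rewrite -(spherical_law_reflection hg hP ab); last exact: measurable_tilted_quadrant.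
have -> : reflection (-1) 0 @^-1` [set z | z.1 <= x /\ (tilt (- rho) z).2 <= y] =
   (B `\` L) `|` (B `&` L0).
  apply/seteqP; split => z; rewrite /reflection /B /L /L0 /tilt/= mul0r addr0
      mulN1r lerNl mul0r add0r mulN1r opprK sqrrN mulrNN.
    rewrite le_eqVlt => -[/predU1P[->|h] h']; first by right.
    by left; split => //; apply/negP; rewrite -ltNge.
  by case=> -[h1 h2]; split => //; [move/negP : h2; rewrite -ltNge => /ltW|rewrite h2].
apply/eqP; rewrite eq_le; apply/andP; split; last first.
  by apply: le_measure; [rewrite inE|rewrite inE; exact: measurableU|exact: subsetUl].
apply: (le_trans (measureU2 _ _ _)) => //.
have I0 : (P (B `&` L0) <= 0)%E.
  by rewrite -(spherical_law_line0 (- x) hg hP) le_measure ?inE.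
by rewrite -[leRHS]adde0 leeD2l.
Qed.

Lemma axis_cdf_cvg_right P x : axis_cdf P y @[y --> x^'+] --> axis_cdf P x.
Proof.
pose X : {mfun (R * R)%type >-> R} := HB.pack (fst : R * R -> R)
  (isMeasurableFun.Build _ _ _ _ (fst : R * R -> R) measurable_fst).
have E y : P [set z | z.1 <= y] = cdf (X : {RV P >-> R}) y.
  by congr (P _); apply/seteqP; split => z /=; rewrite in_itv.
have := @cdf_right_continuous _ _ _ P X x.
rewrite -E => h; apply: fine_cvg.
by rewrite fineK ?fin_num_measure//; exact: measurable_axis_halfplane.
Qed.

Lemma axis_cdf_cvgy1 P : axis_cdf P y @[y --> +oo%R] --> (1 : R).
Proof.
pose X : {mfun (R * R)%type >-> R} := HB.pack (fst : R * R -> R)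
  (isMeasurableFun.Build _ _ _ _ (fst : R * R -> R) measurable_fst).
have E y : P [set z | z.1 <= y] = cdf (X : {RV P >-> R}) y.
  by congr (P _); apply/seteqP; split => z /=; rewrite in_itv.
have := @cvg_cdfy1 _ _ _ P X.
by move=> h; apply: fine_cvg; under eq_fun do rewrite E.
Qed.

(** Right continuity holds for every distribution function; the symmetry [axis_cdfN] carries it to
    the left. *)
Lemma axis_cdf_continuous g P : density_generator g -> elliptical_law g 0 P ->
  continuous (axis_cdf P).
Proof.
move=> hg hP x; apply/left_right_continuousP; split; last exact: axis_cdf_cvg_right.
have -> : axis_cdf P = fun y => 1 - axis_cdf P (- y).
  by apply/funext => y; rewrite (axis_cdfN _ hg hP) subKr.
apply: cvgB; first exact: cvg_cst.
apply/cvg_at_leftNP.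
rewrite [X in X @ _ --> _](_ : _ = axis_cdf P); first exact: axis_cdf_cvg_right.
by apply/funext => y /=; rewrite opprK.
Qed.

Lemma axis_cdf_surj g P u : density_generator g -> elliptical_law g 0 P ->
  0 < u < 1 -> exists x, axis_cdf P x = u.
Proof.
move=> hg hP /andP[u0 u1].
have big (v : R) : v < 1 -> exists2 b, 0 <= b & v < axis_cdf P b.
  move=> v1; have /cvgrPdist_lt /(_ (1 - v)) := @axis_cdf_cvgy1 P.
  rewrite subr_gt0 => /(_ v1) [M [_ hM]].
  exists (`|M| + 1); first by rewrite addr_ge0.
  have /hM : M < `|M| + 1 by rewrite (le_lt_trans (ler_norm _))// ltrDl.
  by rewrite /= distrC ltr_distl => /andP[]; rewrite subKr.
have [b b0 ub] := big _ u1.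
(* By symmetry a value above 1 - u at a is a value below u at -a. *)
have [|a a0 ua] := big (1 - u); first lra.
have [|||c _ <-] := @IVT _ (axis_cdf P) (- a) b u; last by exists c.
- by lra.
- exact/continuous_subspaceT/(axis_cdf_continuous hg hP).
- rewrite (axis_cdfN _ hg hP) ge_min le_max.
  by apply/andP; split; apply/orP; [left|right]; lra.
Qed.

End SphericalCdfSymmetries.

(** * From distribution functions to copulas *)

Section EllipticalCopulas.
Context {R : realType}.
Implicit Types (g : R -> R) (rho u v : R) (P : probability (R * R)%type R).
Implicit Types C : R -> R -> R -> R.

Lemma copula_frechet_bounds (D : R -> R -> R) u v : is_copula D ->
  0 <= u <= 1 -> 0 <= v <= 1 ->
  Num.max (u + v - 1) 0 <= D u v <= Num.min u v.
Proof.
move=> [D01 gD mD iD] u01 v01.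
have [u0 u1] := andP u01; have [v0 v1] := andP v01.
have [Dv0 _] := gD _ v01; have [Du0 D0u] := gD _ u01; have [_ D0v] := gD _ v01.
have [Du1 D1u] := mD _ u01; have [Dv1 D1v] := mD _ v01.
have le01 : 0 <= (1 : R) <= 1 by lra.
have [D10 D01'] := gD 1 le01; have [D11 _] := mD 1 le01.
have [Dge0 _] := andP (D01 _ _ u01 v01).
have h1 := iD 0 u v 1 (lexx _) u0 u1 v0 v1 (lexx _).
have h2 := iD u 1 0 v u0 u1 (lexx _) (lexx _) v0 v1.
have h3 := iD u 1 v 1 u0 u1 (lexx _) v0 v1 (lexx _).
by rewrite ge_max le_min Dge0; apply/andP; split; [|apply/andP; split]; lra.
Qed.

Lemma elliptical_family_frechet_bounds g C rho u v :
  elliptical_copula_family g C -> -1 <= rho <= 1 ->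
  0 <= u <= 1 -> 0 <= v <= 1 ->
  Num.max (u + v - 1) 0 <= C rho u v <= Num.min u v.
Proof.
move=> [hC hC1 hCN1] /andP[]; rewrite le_eqVlt => /predU1P[<- _|rN1].
  move=> u01 v01; rewrite hCN1// lexx le_min !ge_max; lra.
rewrite le_eqVlt => /predU1P[->|r1] u01 v01.
  by rewrite hC1// lexx le_min !ge_max; lra.
have [P _ [cC _]] := hC rho rN1 r1; exact: copula_frechet_bounds.
Qed.

(** Both marginals equal [axis_cdf P] whatever rho is, so different correlations are compared at the
    same point (x, y). With [axis_cdf_surj] this fixes [C rho] on the open square. *)
Lemma sklar_tilted g C P rho x y : density_generator g ->
  elliptical_copula_family g C -> elliptical_law g 0 P -> -1 < rho < 1 ->
  C rho (axis_cdf P x) (axis_cdf P y) = tilted_cdf P rho x y.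
Proof.
move=> hg [hC _ _] hP r1; have [rN1 r1'] := andP r1.
have [Q hQ [_ sQ]] := hC rho rN1 r1'.
have mx (a : R) : measurable (`]-oo, a] `*` [set: R]) by exact: measurableX.
have my (a : R) : measurable ([set: R] `*` `]-oo, a]) by exact: measurableX.
have mxy : measurable (`]-oo, x] `*` `]-oo, y]) by exact: measurableX.
have := sQ x y; rewrite /joint_cdf /marginal_cdf1 /marginal_cdf2.
rewrite !(elliptical_law_tilt hg r1 hQ hP)//.
rewrite /axis_cdf -(spherical_law_tilt_marginal y hg hP r1) => E.
have e1 : tilt rho @^-1` (`]-oo, x] `*` [set: R]) = [set z | z.1 <= x].
  by apply/seteqP; split => z; [case|split => //]; rewrite /= in_itv.
have e2 : tilt rho @^-1` ([set: R] `*` `]-oo, y]) = [set z | (tilt rho z).2 <= y].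
  by apply/seteqP; split => z; [case=> _|split => //]; rewrite /= in_itv.
have e12 : tilt rho @^-1` (`]-oo, x] `*` `]-oo, y]) =
    [set z | z.1 <= x /\ (tilt rho z).2 <= y].
  apply/seteqP; split => z; first by case; rewrite /= !in_itv.
  by case=> h1 h2; split; rewrite /= in_itv.
by move: E; rewrite e1 e2 e12.
Qed.

Lemma elliptical_family_spherical g C : elliptical_copula_family g C ->
  exists P, elliptical_law g 0 P.
Proof. by case=> /(_ 0 (ltrN10 _) (ltr01)) [P hP _] _ _; exists P. Qed.

Lemma elliptical_copula_le g C rho rho' : density_generator g ->
  elliptical_copula_family g C -> -1 <= rho <= 1 -> -1 <= rho' <= 1 ->
  rho <= rho' -> lower_orthant_le (C rho) (C rho').
Proof.
move=> hg hC r1 r1' rr' u v u01 v01.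
have [lo up] := andP (elliptical_family_frechet_bounds hC r1 u01 v01).
have [lo' up'] := andP (elliptical_family_frechet_bounds hC r1' u01 v01).
have Cr1 : rho = -1 -> C rho u v <= C rho' u v.
  by move=> ->; have [_ _ hN] := hC; rewrite hN.
have Cr1' : rho' = 1 -> C rho u v <= C rho' u v.
  by move=> ->; have [_ h1 _] := hC; rewrite h1.
have [->//|rr'N] := eqVneq rho rho'.
have [|rN1] := eqVneq rho (-1); first exact: Cr1.
have [|r'N1] := eqVneq rho' 1; first exact: Cr1'.
have {}r1 : -1 < rho < 1.
  move: r1 r1' rN1 r'N1 rr' rr'N; rewrite !lt_neqAle => /andP[-> _] /andP[_ ?] + *.
  by rewrite eq_sym => ->/=; lra.
have {}r1' : -1 < rho' < 1.
  move: r1 r1' r'N1 rr'; rewrite !lt_neqAle => /andP[/andP[_ ?] _] /andP[_ ->] -> *.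
  by rewrite !andbT; lra.
(* The Frechet-Hoeffding bounds coincide on the boundary of the square, which [axis_cdf_surj] does
   not reach. *)
have det : Num.min u v = Num.max (u + v - 1) 0 -> C rho u v <= C rho' u v.
  by move=> mM; apply: le_trans up _; rewrite mM.
have [u0|u0] := eqVneq u 0;
  first by apply: det; rewrite u0 minEle maxEle; case: leP => ?; case: leP => ?; lra.
have [u1|u1] := eqVneq u 1;
  first by apply: det; rewrite u1 minEle maxEle; case: leP => ?; case: leP => ?; lra.
have [v0|v0] := eqVneq v 0;
  first by apply: det; rewrite v0 minEle maxEle; case: leP => ?; case: leP => ?; lra.
have [v1|v1] := eqVneq v 1;
  first by apply: det; rewrite v1 minEle maxEle; case: leP => ?; case: leP => ?; lra.
have [P hP] := elliptical_family_spherical hC.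
have [|x <-] := axis_cdf_surj hg hP (u := u).
  by move: u01; rewrite !lt_neqAle eq_sym u0 u1.
have [|y <-] := axis_cdf_surj hg hP (u := v).
  by move: v01; rewrite !lt_neqAle eq_sym v0 v1.
by rewrite !(sklar_tilted _ _ hg hC hP)// (tilted_cdf_le _ _ hg hP).
Qed.

Lemma axis_cdf0 g P : density_generator g -> elliptical_law g 0 P ->
  axis_cdf P 0 = 2^-1.
Proof. by move=> hg hP; have := axis_cdfN 0 hg hP; rewrite oppr0; lra. Qed.

Lemma elliptical_copula_lt_half g C rho rho' : density_generator g ->
  elliptical_copula_family g C -> -1 <= rho <= 1 -> -1 <= rho' <= 1 ->
  rho < rho' -> C rho 2^-1 2^-1 < C rho' 2^-1 2^-1.
Proof.
move=> hg hC r1 r1' rr'.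
have h01 : 0 <= (2^-1 : R) <= 1 by lra.
have [P hP] := elliptical_family_spherical hC.
(* Two correlations strictly in between are nondegenerate even if rho = -1 or rho' = 1, so
   strictness is needed only there. *)
pose a := (2 * rho + rho') / 3; pose b := (rho + 2 * rho') / 3.
have a1 : -1 < a < 1 by rewrite /a; lra.
have b1 : -1 < b < 1 by rewrite /b; lra.
have a1' : -1 <= a <= 1 by lra.
have b1' : -1 <= b <= 1 by lra.
have ra : rho <= a by rewrite /a; lra.
have br : b <= rho' by rewrite /b; lra.
have ab : a < b by rewrite /a /b; lra.
apply: le_lt_trans (elliptical_copula_le hg hC r1 a1' ra h01 h01) _.
apply: lt_le_trans (elliptical_copula_le hg hC b1' r1' br h01 h01).
rewrite -(axis_cdf0 hg hP) !(sklar_tilted _ _ hg hC hP)//.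
exact: (tilted_cdf_lt00 hg hP).
Qed.

Lemma elliptical_copula_leP g C rho rho' : density_generator g ->
  elliptical_copula_family g C -> -1 <= rho <= 1 -> -1 <= rho' <= 1 ->
  rho <= rho' <-> lower_orthant_le (C rho) (C rho').
Proof.
move=> hg hC r1 r1'; split; first exact: elliptical_copula_le hC _ _.
have h01 : 0 <= (2^-1 : R) <= 1 by lra.
move=> /(_ _ _ h01 h01); apply: contraTT; rewrite -!ltNge.
exact: (elliptical_copula_lt_half hg hC).
Qed.

End EllipticalCopulas.

(** * The density generator *)

Section RplusCalculus.
Context {R : realType}.
Implicit Types (f : R -> R) (t : R).

Lemma derivable_Rplus_quotient f t (e : R) : derivable_Rplus f -> 0 <= t -> 0 < e ->
  exists2 d : R, 0 < d & forall s, 0 <= s -> s != t -> `|s - t| < d ->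
    `|derive_Rplus f t - Rplus_quotient f t s| < e.
Proof.
move=> df t0 e0; have /cvgrPdist_lt /(_ _ e0) := df t t0.
rewrite near_withinE => -[d /= d0 H]; exists d => // s s0 st sd.
by apply: H => //=; rewrite ?in_itv/= ?s0// distrC.
Qed.

(** Only the values on [[0, +oo[] are controlled; composing with the absolute value turns one-sided
    continuity at 0 into continuity on the whole line. *)
Lemma derivable_Rplus_continuous f :
  derivable_Rplus f -> continuous (fun t : R => f `|t|).
Proof.
move=> df t; apply/cvgrPdist_lt => e e0.
have [d d0 H] := derivable_Rplus_quotient df (normr_ge0 t) ltr01.
pose K := `|derive_Rplus f `|t| | + 1.
have K0 : 0 < K by rewrite ltr_wpDl.
near=> s.
have [->|st] := eqVneq `|s| `|t|; first by rewrite subrr normr0.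
have sd : `|t - s| < Num.min d (e / K).
  by near: s; apply: cvgr_dist_lt => //; rewrite lt_min d0 divr_gt0.
have {sd} : `| `|s| - `|t| | < Num.min d (e / K).
  by apply: le_lt_trans sd; rewrite distrC; exact: ler_dist_dist.
rewrite lt_min => /andP[sd sK].
have q : `|Rplus_quotient f `|t| `|s| | <= K.
  have := H _ (normr_ge0 s) st sd.
  set L := derive_Rplus _ _; set Q := Rplus_quotient _ _ _ => /ltW LQ.
  rewrite -(subKr L Q) (le_trans (ler_normB _ _))// /K lerD2l.
  by [].
have -> : f `|t| - f `|s| = - (Rplus_quotient f `|t| `|s| * (`|s| - `|t|)).
  by rewrite /Rplus_quotient divfK ?opprB// subr_eq0.
rewrite normrN normrM (le_lt_trans (ler_wpM2r _ q))//.
by rewrite mulrC -ltr_pdivlMr.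
Unshelve. all: by end_near. Qed.

Lemma derivable_Rplus_is_derive f t : derivable_Rplus f -> 0 < t ->
  is_derive t 1 f (derive_Rplus f t).
Proof.
move=> df t0.
have H : h^-1 *: ((f \o shift t) (h *: 1) - f t) @[h --> 0^'] --> derive_Rplus f t.
  apply/cvgrPdist_lt => e e0.
  have [d d0 H] := derivable_Rplus_quotient df (ltW t0) e0.
  near=> h.
  have h0 : h != 0 by near: h; exact: nbhs_dnbhs_neq.
  have hd : `|h| < Num.min d t.
    by near: h; apply: dnbhs0_lt; rewrite lt_min d0.
  move: hd; rewrite lt_min => /andP[hd ht].
  have := H (h + t); rewrite addrK /Rplus_quotient addrK.
  rewrite -subr_eq0 addrK => /(_ _ h0 hd) H'.
  rewrite /= /shift /= /GRing.scale/= mulr1 mulrC; apply: H'.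
  by move: ht; rewrite ltr_norml => /andP[]; lra.
by split; [apply/cvg_ex; exists (derive_Rplus f t)|exact/cvg_lim].
Unshelve. all: by end_near. Qed.

Lemma first_nonneg f (a b : R) : continuous f -> a <= b -> f a < 0 -> 0 <= f b ->
  exists c, [/\ a < c, c <= b, 0 <= f c & forall t, a <= t < c -> f t < 0].
Proof.
move=> cf ab fa fb.
pose S := [set t | a <= t /\ 0 <= f t].
have Sb : S b by [].
have lS : has_lbound S by exists a => t [].
have hS : has_inf S by split => //; exists b.
have ac : a <= inf S by apply: lb_le_inf; [exists b|move=> t []].
have fc : 0 <= f (inf S).
  rewrite leNgt; apply/negP => fc.
  have := cvgr_lt _ (cf (inf S)) 0 fc.
  move=> [d /= d0 H]; have [e [ae fe] ed] := inf_adherent d0 hS.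
  have ce : inf S <= e by exact: ge_inf.
  have /H/= : ball_ Num.norm (inf S) d e.
    by rewrite /= distrC ger0_norm ?subr_ge0// ltrBlDl.
  by rewrite ltNge fe.
exists (inf S); split => //.
- by rewrite lt_neqAle ac andbT; apply/eqP => e; move: fa; rewrite e ltNge fc.
- exact: ge_inf.
- move=> t /andP[at_ tc]; rewrite ltNge; apply/negP => ft.
  by move: tc; rewrite ltNge => /negP; apply; exact: ge_inf.
Qed.

End RplusCalculus.

Section NegativeDerivative.
Context {R : realType}.
Implicit Types (f : R -> R) (t : R).

Lemma is_derive_exprn n t :
  is_derive t 1 (fun x : R => x ^+ n) (n%:R * t ^+ n.-1).
Proof.
by apply: DeriveDef; [exact: exprn_derivable|rewrite exp_derive [LHS]mulr1].
Qed.

Lemma is_derive_invr t : t != 0 ->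
  is_derive t 1 (fun x : R => x^-1) (- t^-1 ^+ 2).
Proof.
move=> t0; apply: is_derive_eq; first exact: (is_deriveV t0 (is_derive_id t 1)).
by rewrite [LHS]mulr1 exprVn.
Qed.

(* On a component of {f < 0}, t^N f decreases and t^-N f increases, so f cannot
   reach 0 at a positive end point of the component. *)
Lemma elasticity_bounded_lt0 f n (a : R) : derivable_Rplus f ->
  0 < a -> f a < 0 ->
  (forall t, 0 < t -> f t < 0 -> `|t * derive_Rplus f t / f t| <= n.+1%:R) ->
  forall t, 0 < t -> f t < 0.
Proof.
move=> df a0 fa bnd b b0; rewrite ltNge; apply/negP => fb.
have cf := derivable_Rplus_continuous df.
have D t : 0 < t -> is_derive t 1 f (derive_Rplus f t).
  exact: derivable_Rplus_is_derive.
have bnd2 t : 0 < t -> f t < 0 ->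
    n.+1%:R * f t + t * derive_Rplus f t <= 0 /\
    0 <= t * derive_Rplus f t - n.+1%:R * f t.
  move=> t0 ft; have := bnd t t0 ft; rewrite ler_norml => /andP[].
  rewrite ler_ndivlMr// ler_ndivrMr//; lra.
case: (leP a b) => [ab|/ltW ba].
  have [||c [ac cb fc H]] := @first_nonneg _ _ a b cf ab.
  - by rewrite gtr0_norm.
  - by rewrite gtr0_norm.
  have c0 : 0 < c by apply: lt_trans ac.
  move: fc; rewrite gtr0_norm// => fc.
  (* Going right from a, h would pass from a negative value to a nonnegative one although its
     derivative is nonpositive. *)
  pose h t : R := t ^+ n.+1 * f t.
  pose dh t : R := t ^+ n.+1 * derive_Rplus f t + f t * (n.+1%:R * t ^+ n).
  have Dh t : 0 < t -> is_derive t 1 h (dh t).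
    move=> t0; have Dt := D t t0.
    apply: (is_derive_eq (is_deriveM (is_derive_exprn n.+1 t) Dt)).
    by [].
  have [||t] := @MVT _ h dh a c ac.
  - by move=> t; rewrite in_itv/= => /andP[at_ _]; apply: Dh; exact: lt_trans at_.
  - apply: derivable_within_continuous => t; rewrite in_itv/= => /andP[at_ _].
    by have [] := Dh t (lt_le_trans a0 at_).
  rewrite in_itv/= => /andP[at_ tc] E.
  have t0 : 0 < t by apply: lt_trans at_.
  have := H t; rewrite (ltW at_) tc gtr0_norm// => /(_ isT) ft.
  have [b1 _] := bnd2 t t0 ft.
  have dh0 : dh t <= 0.
    rewrite (_ : dh t = t ^+ n * (n.+1%:R * f t + t * derive_Rplus f t)).
      by rewrite pmulr_rle0// exprn_gt0.
    by rewrite /dh exprSr; ring.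
  have hc : 0 <= h c by rewrite /h mulr_ge0// exprn_ge0 ?ltW.
  have ha : h a < 0 by rewrite /h pmulr_rlt0// exprn_gt0.
  nra.
have bnd' : 0 < b <= a by rewrite b0.
(* [first_nonneg] searches to the right; applied to the even extension on [-a, -b] it yields d = -c,
   with f negative on ]d, a]. *)
have [|||c [ac cb fc H]] := @first_nonneg _ (fun t => f `|t|) (- a) (- b) cf.
- by rewrite lerN2.
- by rewrite normrN gtr0_norm.
- by rewrite normrN gtr0_norm.
move: ac cb fc H; rewrite -(opprK c); set d := - c; rewrite ltrN2 lerN2 => da bd.
have d0 : 0 < d by apply: lt_le_trans bd.
rewrite normrN gtr0_norm// => fd H.
pose h t : R := t^-1 ^+ n.+1 * f t.
pose dh t : R := t^-1 ^+ n.+1 * derive_Rplus f t - f t * (n.+1%:R * t^-1 ^+ n * t^-1 ^+ 2).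
have Dh t : 0 < t -> is_derive t 1 h (dh t).
  move=> t0; have Dt := D t t0; have tN0 : t != 0 by rewrite gt_eqF.
  have DV := is_derive1_comp (is_derive_exprn n.+1 t^-1) (is_derive_invr tN0).
  apply: (is_derive_eq (is_deriveM DV Dt)).
  by rewrite /dh /GRing.scale/=; ring.
have [||t] := @MVT _ h dh d a da.
- by move=> t; rewrite in_itv/= => /andP[dt _]; apply: Dh; exact: lt_trans dt.
- apply: derivable_within_continuous => t; rewrite in_itv/= => /andP[dt _].
  by have [] := Dh t (lt_le_trans d0 dt).
rewrite in_itv/= => /andP[dt ta] E.
have t0 : 0 < t by apply: lt_trans dt.
have := H (- t); rewrite lerN2 (ltW ta) ltrN2 dt normrN gtr0_norm// => /(_ isT) ft.
have [_ b2] := bnd2 t t0 ft.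
have dh0 : 0 <= dh t.
  rewrite (_ : dh t = t^-1 ^+ n.+2 * (t * derive_Rplus f t - n.+1%:R * f t)).
    by rewrite mulr_ge0// exprn_ge0// invr_ge0 ltW.
  by rewrite /dh !exprSr; field; rewrite gt_eqF.
have hc : 0 <= h d by rewrite /h mulr_ge0// exprn_ge0// invr_ge0 ltW.
have ha : h a < 0 by rewrite /h pmulr_rlt0// exprn_gt0// invr_gt0.
nra.
Qed.

End NegativeDerivative.

(** * Log-supermodularity of the elliptical density *)

Section Supermodularity.
Context {R : realType}.
Implicit Types (x y t : R).

Lemma is_derive_ge0_le (f df : R -> R) (a b : R) : a <= b ->
  {within `[a, b], continuous f} ->
  (forall x, a < x < b -> is_derive x 1 f (df x)) ->
  (forall x, a < x < b -> 0 <= df x) -> f a <= f b.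
Proof.
rewrite le_eqVlt => /predU1P[->//|ab] cf Df df0.
have Dm x : x \in `]a, b[ -> is_derive x 1 f (df x) by rewrite in_itv; exact: Df.
have [x] := MVT ab Dm cf.
rewrite in_itv/= => xab E; rewrite -subr_ge0 E mulr_ge0 ?df0//.
by rewrite subr_ge0 ltW.
Qed.

Lemma quad_formC rho x y : quad_form rho (x, y) = quad_form rho (y, x).
Proof. by rewrite /quad_form/=; congr (_ / _); ring. Qed.

Lemma quad_form_gt0 rho x y : -1 < rho < 1 -> y != 0 -> 0 < quad_form rho (x, y).
Proof.
move=> r1 y0; rewrite quad_formE2//= ltr_pwDl//.
  by rewrite exprn_even_gt0.
by rewrite divr_ge0 ?sqr_ge0// ltW// onemX2_gt0.
Qed.

Lemma is_derive_quad_form1 rho x y :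
  is_derive x 1 (fun x => quad_form rho (x, y)) (2 * (x - rho * y) / (1 - rho ^+ 2)).
Proof.
apply/is_derive1_caratheodory.
exists (fun z => (z + x - 2 * rho * y) / (1 - rho ^+ 2)); split.
- by move=> z; rewrite /quad_form/=; ring.
- apply: cvgM; last exact: cvg_cst.
  apply: cvgB; last exact: cvg_cst.
  by apply: cvgD; [exact: cvg_id|exact: cvg_cst].
- by ring.
Qed.

Lemma quad_form_continuous1 rho y : continuous (fun x => quad_form rho (x, y)).
Proof.
move=> x; have [d _] := is_derive_quad_form1 rho x y.
exact/differentiable_continuous/derivable1_diffP.
Qed.

Lemma quad_form_continuous2 rho x : continuous (fun y => quad_form rho (x, y)).
Proof.
have -> : (fun y => quad_form rho (x, y)) = (fun y => quad_form rho (y, x)).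
  by apply/funext => y; rewrite quad_formC.
exact: quad_form_continuous1.
Qed.

(** With p = (x - rho y)(y - rho x) and N the form on the right, (1 - rho) N - 2 p and (1 + rho) N +
    2 p are nonnegative multiples of (x - y)^2 and (x + y)^2. The upper bound on k serves p >= 0,
    the lower one p < 0. *)
Lemma mixed_term_le rho (k x y : R) : 0 <= rho < 1 ->
  k * (1 - rho) <= rho -> - rho <= k * (1 + rho) ->
  2 * k * (x - rho * y) * (y - rho * x) <=
  rho * (x ^+ 2 - 2 * rho * x * y + y ^+ 2).
Proof.
move=> /andP[r0 r1] k1 k2; set p := (x - rho * y) * (y - rho * x).
set N := _ - _ + _.
have p1 : 2 * p <= (1 - rho) * N.
  rewrite -subr_ge0 (_ : _ - _ = (1 + rho) * (x - y) ^+ 2); last by rewrite /p /N; ring.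
  by rewrite mulr_ge0 ?sqr_ge0//; lra.
have p2 : - (2 * p) <= (1 + rho) * N.
  rewrite -subr_ge0 (_ : _ - _ = (1 - rho) * (x + y) ^+ 2); last by rewrite /p /N; ring.
  by rewrite mulr_ge0 ?sqr_ge0//; lra.
rewrite -mulrA -/p; have [p0|p0] := leP 0 p.
  have h : k * p * (1 - rho) <= rho * p by rewrite mulrAC ler_wpM2r.
  rewrite -(@ler_pM2r _ (1 - rho)); last by lra.
  nra.
have h : - rho * p >= k * p * (1 + rho) by rewrite mulrAC ler_wnM2r// ltW.
rewrite -(@ler_pM2r _ (1 + rho)); last by lra.
nra.
Qed.

Variables (phi : R -> R) (rho : R).
Let psi := derive_Rplus phi.
Hypotheses (dphi : derivable_Rplus phi) (dpsi : derivable_Rplus psi).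
Hypothesis rho01 : 0 <= rho < 1.
Hypothesis psi_lt0 : forall t, 0 < t -> psi t < 0.
Hypothesis psi_el : forall t, 0 < t ->
  - (rho / (1 + rho)) <= t * derive_Rplus psi t / psi t <= rho / (1 - rho).

Let rho1 : -1 < rho < 1. Proof. by case/andP: rho01 => ? ?; lra. Qed.
Let D : R := 1 - rho ^+ 2.
Let D0 : 0 < D. Proof. exact: onemX2_gt0. Qed.
Let q x y := quad_form rho (x, y).

(** The compared quantity is the derivative of phi(q) in y; its own derivative in x is [psi / q]
    times a nonpositive bracket, up to a positive constant. As y != 0, q stays positive and
    one-sided derivatives at 0 do not occur. *)
Let cross_derivative_nondecreasing x x' y : y != 0 -> x <= x' ->
  psi (q x y) * (2 * (y - rho * x) / D) <= psi (q x' y) * (2 * (y - rho * x') / D).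
Proof.
move=> y0 xx'.
pose df x := psi (q x y) * (- (2 * rho / D)) + (2 * (y - rho * x) / D) *
  (derive_Rplus psi (q x y) * (2 * (x - rho * y) / D)).
have Df (z : R) : is_derive z 1 (fun x => psi (q x y) * (2 * (y - rho * x) / D)) (df z).
  have q0 : 0 < q z y by exact: quad_form_gt0.
  have D1 := @is_derive1_comp _ psi (fun x => quad_form rho (x, y)) z _ _
    (derivable_Rplus_is_derive dpsi q0) (is_derive_quad_form1 rho z y).
  have D2 : is_derive z 1 (fun x => 2 * (y - rho * x) / D) (- (2 * rho / D)).
    apply/is_derive1_caratheodory; exists (fun=> - (2 * rho / D)); split => //.
      by move=> x0; ring.
    exact: cvg_cst.
  by apply: (is_derive_eq (is_deriveM D1 D2)).
apply: (is_derive_ge0_le xx' _ (fun z _ => Df z)).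
  by apply: derivable_within_continuous => z _; have [] := Df z.
move=> z _; have q0 : 0 < q z y by exact: quad_form_gt0.
have /andP[k2 k1] := psi_el q0; have p0 := psi_lt0 q0.
set k := q z y * derive_Rplus psi (q z y) / psi (q z y) in k1 k2.
have [r0 r1] := andP rho01.
have {}k1 : k * (1 - rho) <= rho by rewrite -ler_pdivlMr//; lra.
have {}k2 : - rho <= k * (1 + rho) by rewrite -ler_pdivrMr ?mulNr//; lra.
have := mixed_term_le z y rho01 k1 k2.
have -> : z ^+ 2 - 2 * rho * z * y + y ^+ 2 = q z y * D.
  by rewrite /q /quad_form/= divfK// gt_eqF.
move=> h; rewrite (_ : df z = psi (q z y) / q z y * (2 / D ^+ 2) *
   (2 * k * (z - rho * y) * (y - rho * z) - rho * (q z y * D))).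
  rewrite mulr_le0//; last by rewrite subr_le0.
  by rewrite mulr_le0_ge0 ?divr_ge0 ?exprn_ge0 ?(ltW D0)// pmulr_lle0 ?invr_gt0// ltW.
have qN0 : q z y != 0 by rewrite gt_eqF.
have DN0 : D != 0 by rewrite gt_eqF.
have pN0 : psi (q z y) != 0 by rewrite lt_eqF.
by rewrite /df /k; field; rewrite qN0 DN0 pN0.
Qed.

Lemma generator_supermodular x x' y y' : x <= x' -> y <= y' ->
  phi (q x y') + phi (q x' y) <= phi (q x y) + phi (q x' y').
Proof.
move=> xx' yy'.
pose L y := phi (q x' y) - phi (q x y).
suff : L y <= L y' by rewrite /L; lra.
have cL a b : {within `[a, b], continuous L}.
  apply: continuous_subspaceT => z.
  have cq u : continuous (fun y => phi (q u y)).
    have -> : (fun y => phi (q u y)) = (fun t => phi `|t|) \o (fun y => q u y).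
      by apply/funext => v /=; rewrite ger0_norm//; exact: quad_form_ge0.
    move=> w; apply: continuous_comp; last exact: derivable_Rplus_continuous.
    exact: quad_form_continuous2.
  by apply: cvgB; exact: cq.
have DL (z : R) : z != 0 -> is_derive z 1 L
    (psi (q x' z) * (2 * (z - rho * x') / D) - psi (q x z) * (2 * (z - rho * x) / D)).
  move=> z0.
  have Dq u : is_derive z 1 (fun y => phi (q u y)) (psi (q u z) * (2 * (z - rho * u) / D)).
    have q0 : 0 < q u z by exact: quad_form_gt0.
    have D1 : is_derive z 1 (fun y => quad_form rho (u, y)) (2 * (z - rho * u) / D).
      by under eq_fun do rewrite quad_formC; exact: is_derive_quad_form1.
    have H := @is_derive1_comp _ phi (fun y => quad_form rho (u, y)) z _ _
      (derivable_Rplus_is_derive dphi q0) D1.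
    exact: H.
  by apply: is_deriveB.
(* The derivative is available only for z != 0, so monotonicity is shown on each side of 0 and glued
   there by continuity. *)
have mono a b : a <= b -> 0 <= a \/ b <= 0 -> L a <= L b.
  move=> ab sg; have z0 z : a < z < b -> z != 0.
    by move=> /andP[az zb]; case: sg => h; [rewrite gt_eqF//; exact: le_lt_trans az
      |rewrite lt_eqF//; exact: lt_le_trans h].
  apply: (is_derive_ge0_le ab (cL a b) (fun z h => DL z (z0 z h))).
  by move=> z /z0 h; rewrite subr_ge0 cross_derivative_nondecreasing.
have [y0|/ltW y0] := leP 0 y; first by apply: mono => //; left.
have [y'0|/ltW y'0] := leP 0 y'; last by apply: mono => //; right.
by apply: (@le_trans _ _ (L 0)); apply: mono => //; [right|left].
Qed.

End Supermodularity.

(** * Conditional distribution functions *)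

Section DecreasingGenerator.
Context {R : realType}.
Local Notation mu := (@lebesgue_measure R).
Local Notation mu2 := (mu \x mu)%E.
Implicit Types (x y s t : R).

Variables (g : R -> R) (P : probability (R * R)%type R).
Hypotheses (hg : density_generator g) (hP : elliptical_law g 0 P).
Hypothesis g_nonincreasing : forall s t, 0 <= s -> s <= t -> g t <= g s.

Let g0 t : 0 <= t -> 0 <= g t. Proof. exact: hg.2. Qed.

Let integral_radial_lty : (\int[mu2]_z (radial g z)%:E < +oo)%E.
Proof.
have [c c0 E] := spherical_law_radial hg hP.
have := E setT measurableT; rewrite probability_setT.
have : (0 <= \int[mu2]_z (radial g z)%:E)%E.
  by apply: integral_ge0 => z _; rewrite lee_fin radial_ge0.
case: (\int[mu2]_z _)%E => [r _ _||//]; first exact: ltry.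
by move=> _; rewrite gt0_muley ?lte_fin.
Qed.

Let measurable_g_shift (a : R) : measurable_fun setT (fun w : R => (g (1 + (w + a) ^+ 2))%:E).
Proof.
apply/measurable_EFinP.
apply: (measurable_generator_comp (q := fun w : R => 1 + (w + a) ^+ 2) hg).
  by apply: measurable_funD => //; apply: measurable_funX; exact: measurable_funD.
by move=> w; rewrite addr_ge0 ?sqr_ge0.
Qed.

Let shift_ge0 (a w : R) : 0 <= 1 + (w + a) ^+ 2.
Proof. by rewrite addr_ge0 ?sqr_ge0. Qed.

(** For x in ]0, 1[ the slice of the radial density at x dominates the one at 1; averaging over such
    x bounds the latter by the total mass. The term [w + 0] is what undoing the translation below
    leaves. *)
Let integral_shifted_slice_lty : (\int[mu]_w (g (1 + (w + 0) ^+ 2))%:E < +oo)%E.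
Proof.
apply: le_lt_trans integral_radial_lty; set K := (\int[mu]_w _)%E.
have mr : measurable_fun setT (fun z => (radial g z)%:E).
  by apply/measurable_EFinP; exact: measurable_radial.
have r0 z : (0 <= (radial g z)%:E)%E by rewrite lee_fin radial_ge0.
have K0 : (0 <= K)%E by apply: integral_ge0 => w _; rewrite lee_fin g0.
rewrite fubini_tonelli1//.
have mF := @measurable_fun_fubini_tonelli_F _ _ _ _ _ mu _ mr r0.
have F0 x : (0 <= fubini_F mu (fun z => (radial g z)%:E) x)%E.
  by apply: integral_ge0 => w _; exact: r0.
apply: (@le_trans _ _
    (\int[mu]_(x in `]0%R, 1%R[) fubini_F mu (fun z => (radial g z)%:E) x)%E);
  last first.
  by apply: ge0_subset_integral.
have -> : K = (\int[mu]_(x in `]0%R, 1%R[) cst K x)%E.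
  by rewrite integral_cst//= lebesgue_measure_itv/= lte_fin ltr01 oppr0 adde0 mule1.
apply: ge0_le_integral => //.
  exact: measurable_funTS.
move=> x; rewrite /= in_itv/= => /andP[x0 x1]; apply: ge0_le_integral => //.
- by move=> w _; rewrite lee_fin g0.
- exact: measurable_g_shift.
- exact: (measurable_fun_pair2 x mr).
- move=> w _; rewrite lee_fin /radial/= addr0; apply: g_nonincreasing.
    by rewrite addr_ge0 ?sqr_ge0.
  by rewrite lerD2r; nra.
Qed.

Let integrable_g_shift (a : R) :
  mu.-integrable setT (fun w : R => (g (1 + (w + a) ^+ 2))%:E).
Proof.
apply/integrableP; split; first exact: measurable_g_shift.
under eq_integral do rewrite gee0_abs ?lee_fin ?g0//.
have f0 w : (0 <= (g (1 + (w + a) ^+ 2))%:E)%E by rewrite lee_fin g0.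
rewrite (ge0_integral_affine (- a) (oner_neq0 R) (measurable_g_shift a) f0).
rewrite normr1 mul1e; under eq_integral do rewrite mul1r addrAC -addrA subrr.
exact: integral_shifted_slice_lty.
Qed.

(** The slice through the origin is the largest one, and Fubini gives finiteness only almost
    everywhere. It is bounded by g(0) on [-1, 1], and outside by a translated slice at 1, since w^2
    >= 1 + (|w| - 1)^2 for |w| >= 1. *)
Lemma integrable_generator_sqr : mu.-integrable setT (fun w : R => (g (w ^+ 2))%:E).
Proof.
pose h (w : R) := (g 0 * \1_(`[-1, 1]) w + g (1 + (w + -1) ^+ 2) + g (1 + (w + 1) ^+ 2)).
have ih : mu.-integrable setT (EFin \o h).
  have -> : EFin \o h = ((fun w : R => (g 0)%:E * (\1_(`[-1, 1]) w)%:E) \+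
      (fun w : R => (g (1 + (w + -1) ^+ 2)%R)%:E) \+
      (fun w : R => (g (1 + (w + 1) ^+ 2)%R)%:E))%E.
    by apply/funext => w; rewrite /= /h !EFinD EFinM.
  apply: (integrableD measurableT); last exact: (integrable_g_shift 1).
  apply: (integrableD measurableT); last exact: (integrable_g_shift (-1)).
  apply: (integrableZl measurableT).
  exact: integrable_indic_itv.
apply: (le_integrable measurableT _ _ ih).
  apply/measurable_EFinP; apply: (measurable_generator_comp (q := fun w : R => w ^+ 2) hg).
    exact: measurable_funX.
  by move=> w; exact: sqr_ge0.
move=> w _; have h1 := g0 (shift_ge0 (-1) w); have h2 := g0 (shift_ge0 1 w).
have h3 := g0 (lexx 0).
have h4 : 0 <= g 0 * \1_(`[-1, 1]) w by rewrite mulr_ge0.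
rewrite lee_fin !ger0_norm ?g0 ?sqr_ge0//; last first.
  by rewrite /h !addr_ge0.
have [w1|w1] := leP (-1) w; have [w2|w2] := leP w 1.
- apply: (@le_trans _ _ (g 0)); first by apply: g_nonincreasing => //; exact: sqr_ge0.
  by rewrite /h indicE mem_set ?mulr1 -?addrA ?lerDl ?addr_ge0//= in_itv/= w1.
- apply: (@le_trans _ _ (g (1 + (w + -1) ^+ 2))); last by rewrite /h; lra.
  by apply: g_nonincreasing => //; nra.
- apply: (@le_trans _ _ (g (1 + (w + 1) ^+ 2))); last by rewrite /h; lra.
  by apply: g_nonincreasing => //; nra.
- by lra.
Qed.

End DecreasingGenerator.

Section Slices.
Context {R : realType}.
Local Notation mu := (@lebesgue_measure R).
Implicit Types (x y s t : R) (A : set R).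

Variables (g : R -> R) (rho : R).
Hypotheses (hg : density_generator g) (rho1 : -1 < rho < 1).
Hypothesis g_nonincreasing : forall s t, 0 <= s -> s <= t -> g t <= g s.
Hypothesis g_gt0 : forall t, 0 <= t -> 0 < g t.
Hypothesis g_continuous : continuous (fun t => g `|t|).
Hypothesis g_integrable : mu.-integrable setT (fun w : R => (g (w ^+ 2))%:E).

(** Up to a constant and the marginal density, the conditional probability of A given that the first
    coordinate is x. *)
Definition slice A x : R := \int[mu]_(s in A) g (quad_form rho (x, s)).

Let q0 x s : 0 <= quad_form rho (x, s). Proof. exact: quad_form_ge0. Qed.

Let d_le x s : g (quad_form rho (x, s)) <= g (s ^+ 2).
Proof.
apply: g_nonincreasing; first exact: sqr_ge0.
rewrite quad_formE2//= lerDl divr_ge0 ?sqr_ge0//.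
exact/ltW/onemX2_gt0.
Qed.

Lemma measurable_slice_density x :
  measurable_fun setT (fun s => g (quad_form rho (x, s))).
Proof.
apply: (measurable_generator_comp (q := fun s : R => quad_form rho (x, s)) hg).
  exact: (measurable_fun_pair2 x (measurable_quad_form rho)).
by move=> s; exact: q0.
Qed.

Lemma integrable_slice_density A x : measurable A ->
  mu.-integrable A (EFin \o (fun s => g (quad_form rho (x, s)))).
Proof.
move=> mA; apply: (integrableS measurableT) => //.
apply: (le_integrable measurableT _ _ g_integrable).
  by apply/measurable_EFinP; exact: measurable_slice_density.
by move=> s _ /=; rewrite lee_fin !ger0_norm ?d_le// hg.2 ?sqr_ge0.
Qed.

Lemma slice_ge0 A x : 0 <= slice A x.
Proof. by apply: Rintegral_ge0 => s _; exact/ltW/g_gt0. Qed.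

Lemma slice_split x y : slice setT x = slice `]-oo, y] x + slice `]y, +oo[ x.
Proof.
rewrite /slice -Rintegral_setU//.
- by congr (Rintegral _ _ _); rewrite -itv_bndbnd_setU// set_itvE.
- by apply: integrable_slice_density; exact: measurableU.
- rewrite disj_set2E; apply/eqP/seteqP; split => // s /=.
  by rewrite !in_itv/= andbT => -[sy]; rewrite ltNge sy.
Qed.

Lemma slice_total_lower_bound (a b : R) : exists2 m : R, 0 < m &
  forall x, a <= x <= b -> m <= slice setT x.
Proof.
(* An upper bound of the form for x in [a, b] and s in [0, 1], since x^2 - 2 rho x s + s^2 <= 2 x^2
   + 2 s^2. *)
pose Q := (2 * (a ^+ 2 + b ^+ 2) + 2) / (1 - rho ^+ 2).
have D0 := onemX2_gt0 rho1.
have Q0 : 0 <= Q by rewrite divr_ge0 ?(ltW D0)// addr_ge0// mulr_ge0// addr_ge0 ?sqr_ge0.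
exists (g Q); first exact: g_gt0.
move=> x /andP[ax xb].
have -> : g Q = \int[mu]_(s in `[0, 1]) g Q.
  by rewrite Rintegral_cst//= lebesgue_measure_itv/= lte_fin ltr01 oppr0 adde0 mulr1.
apply: (@le_trans _ _ (slice `[0, 1] x)).
  apply: le_Rintegral => //.
  - apply: continuous_compact_integrable; first exact: segment_compact.
    by apply: continuous_subspaceT => ?; exact: cvg_cst.
  - exact: integrable_slice_density.
  - move=> s; rewrite /= in_itv/= => /andP[s0 s1]; apply: g_nonincreasing => //.
    rewrite /quad_form/= ler_pM2r ?invr_gt0//.
    have xab : x ^+ 2 <= a ^+ 2 + b ^+ 2.
      by have [x0|x0] := leP 0 x; nra.
    have s1' : s ^+ 2 <= 1 by nra.
    suff : 0 <= (x + rho * s) ^+ 2 + (1 - rho ^+ 2) * s ^+ 2 by lra.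
    by apply: addr_ge0; rewrite ?sqr_ge0// mulr_ge0 ?sqr_ge0 ?(ltW D0).
rewrite /slice /Rintegral fine_le//.
- exact/integrable_fin_num/integrable_slice_density.
- exact/integrable_fin_num/integrable_slice_density.
apply: ge0_subset_integral => //.
  by apply/measurable_EFinP; exact: measurable_slice_density.
by move=> s _; rewrite lee_fin; exact/ltW/g_gt0.
Qed.

Lemma slice_total_gt0 x : 0 < slice setT x.
Proof.
have [m m0 h] := slice_total_lower_bound x x.
by apply: lt_le_trans m0 _; apply: h; rewrite lexx.
Qed.

(** Dominated convergence: the integrable majorant g(s^2) does not depend on x. *)
Lemma slice_continuous A : measurable A -> continuous (slice A).
Proof.
move=> mA x.
have cd s : continuous (fun x => g (quad_form rho (x, s))).
  have -> : (fun x => g (quad_form rho (x, s))) =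
      (fun t => g `|t|) \o (fun x => quad_form rho (x, s)).
    by apply/funext => z /=; rewrite ger0_norm.
  by move=> z; apply: continuous_comp; [exact: quad_form_continuous1|exact: g_continuous].
have := @continuity_under_integral _ _ _ mu
  (fun x s => g (quad_form rho (x, s))) A mA (x - 1) (x + 1) _ _ (fun s => g (s ^+ 2)) _ _.
apply.
- by move=> z _; exact: integrable_slice_density.
- by apply: aeW => s _ z _; exact: cd.
- by apply: (integrableS measurableT).
- move=> z _; apply: aeW => s _; by rewrite ger0_norm ?d_le// hg.2.
- by rewrite inE/= in_itv/=; apply/andP; split; lra.
Qed.

Definition conditional_cdf y x : R := slice `]-oo, y] x / slice setT x.

Lemma conditional_cdf_continuous y : continuous (conditional_cdf y).
Proof.
move=> x; apply: cvgM; first exact: slice_continuous.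
apply: cvgV; first by rewrite gt_eqF// slice_total_gt0.
exact: slice_continuous.
Qed.

Hypothesis g_tp2 : forall x x' y y', x <= x' -> y <= y' ->
  g (quad_form rho (x, y')) * g (quad_form rho (x', y)) <=
  g (quad_form rho (x, y)) * g (quad_form rho (x', y')).

(* The likelihood ratio of two slices is monotone, hence below its value at y on
   ]-oo, y] and above it on ]y, +oo[. *)
Lemma conditional_cdf_nonincreasing y : {homo conditional_cdf y : x x' /~ x <= x'}.
Proof.
move=> x' x xx'.
rewrite /conditional_cdf ler_pdivrMr ?slice_total_gt0// mulrAC.
rewrite ler_pdivlMr ?slice_total_gt0// !(slice_split _ y).
pose r := g (quad_form rho (x', y)) / g (quad_form rho (x, y)).
have dy0 : 0 < g (quad_form rho (x, y)) by exact: g_gt0.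
have irx A : measurable A ->
    mu.-integrable A (EFin \o (fun s => r * g (quad_form rho (x, s)))).
  move=> mA; have := @integrableZl _ _ _ mu A mA r _ (integrable_slice_density x mA).
  by apply: eq_integrable => // s _; rewrite /= EFinM.
have lo : slice `]-oo, y] x' <= r * slice `]-oo, y] x.
  rewrite /slice -RintegralZl//; last exact: integrable_slice_density.
  apply: le_Rintegral => //.
  - exact: integrable_slice_density.
  - exact: irx.
  - move=> s; rewrite /= in_itv/= => sy.
    by rewrite /r mulrAC ler_pdivlMr// mulrC [leRHS]mulrC g_tp2.
have up : r * slice `]y, +oo[ x <= slice `]y, +oo[ x'.
  rewrite /slice -RintegralZl//; last exact: integrable_slice_density.
  apply: le_Rintegral => //.
  - exact: irx.
  - exact: integrable_slice_density.
  - move=> s; rewrite /= in_itv/= andbT => /ltW sy.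
    by rewrite /r mulrAC ler_pdivrMr// [leLHS]mulrC [leRHS]mulrC g_tp2.
have := slice_ge0 `]-oo, y] x; have := slice_ge0 `]y, +oo[ x.
nra.
Qed.

End Slices.

(** * Increments of the joint and marginal distribution functions *)

Section ConditionalIncrements.
Context {R : realType}.
Local Notation mu := (@lebesgue_measure R).
Local Notation mu2 := (mu \x mu)%E.
Implicit Types (x y s t : R) (A : set R).

Variables (g : R -> R) (rho : R) (P Q : probability (R * R)%type R).
Hypotheses (hg : density_generator g) (rho1 : -1 < rho < 1).
Hypotheses (hP : elliptical_law g 0 P) (hQ : elliptical_law g rho Q).
Hypothesis g_nonincreasing : forall s t, 0 <= s -> s <= t -> g t <= g s.
Hypothesis g_gt0 : forall t, 0 <= t -> 0 < g t.
Hypothesis g_continuous : continuous (fun t => g `|t|).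

Let g_integrable : mu.-integrable setT (fun w : R => (g (w ^+ 2))%:E).
Proof. exact: integrable_generator_sqr hP _. Qed.

Lemma elliptical_law_strip : exists2 c : R, 0 < c &
  forall (x1 x2 : R) A, measurable A ->
  Q (`]x1, x2] `*` A) = (\int[mu]_(x in `]x1, x2]) (c * slice g rho A x)%:E)%E.
Proof.
have [c c0 E] := hQ.
have s0 : 0 < (Num.sqrt (1 - rho ^+ 2))^-1 by rewrite invr_gt0 sqrtr_gt0 onemX2_gt0.
pose k := c * (Num.sqrt (1 - rho ^+ 2))^-1.
have k0 : 0 < k by rewrite mulr_gt0.
exists k => // x1 x2 A mA.
have mB : measurable (`]x1, x2] `*` A) by exact: measurableX.
have md : measurable_fun setT (fun z => (c * elliptical_density g rho z)%:E).
  apply/measurable_EFinP; apply: measurable_funM => //.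
  exact: measurable_elliptical_density.
rewrite E// integral_mkcond fubini_tonelli1; last 2 first.
- by apply/(measurable_restrictT _ _).1 => //; exact: measurable_funTS.
- move=> z; rewrite patchE; case: ifP => // _.
  by rewrite lee_fin mulr_ge0 ?(ltW c0)// elliptical_density_ge0.
rewrite [RHS]integral_mkcond; apply: eq_integral => x _; rewrite /fubini_F patchE.
case: ifPn => [xI|xI]; last first.
  apply: integral0_eq => s _; rewrite patchE memNset// => -[/= h _].
  by move: xI; rewrite notin_setE.
transitivity (\int[mu]_(s in A) (k%:E * (g (quad_form rho (x, s)))%:E))%E.
  rewrite [RHS]integral_mkcond; apply: eq_integral => s _; rewrite !patchE.
  have -> : ((x, s) \in `]x1, x2] `*` A) = (s \in A).
    apply/idP/idP; rewrite !inE; first by case.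
    by split => //=; exact: set_mem xI.
  by case: ifP => // _; rewrite -EFinM /k -mulrA.
have isd := integrable_slice_density hg rho1 g_nonincreasing g_integrable x mA.
by rewrite integralZl// -[X in (_ * X)%E]fineK ?integrable_fin_num.
Qed.

Lemma tilted_cdf_law x y : tilted_cdf P rho x y = fine (Q (`]-oo, x] `*` `]-oo, y])).
Proof.
rewrite (elliptical_law_tilt hg rho1 hQ hP); last exact: measurableX.
congr fine; rewrite (_ : tilt rho @^-1` _ =
  [set z | z.1 <= x /\ (tilt rho z).2 <= y])//.
Qed.

Lemma axis_cdf_law x : axis_cdf P x = fine (Q (`]-oo, x] `*` [set: R])).
Proof.
rewrite (elliptical_law_tilt hg rho1 hQ hP); last exact: measurableX.
congr fine; rewrite (_ : tilt rho @^-1` _ = [set z | z.1 <= x])//.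
by apply/seteqP; split => z; [case|split => //]; rewrite /= in_itv.
Qed.

Lemma law_strip_diff (x1 x2 : R) A : measurable A -> x1 <= x2 ->
  fine (Q (`]-oo, x2] `*` A)) - fine (Q (`]-oo, x1] `*` A)) =
  fine (Q (`]x1, x2] `*` A)).
Proof.
move=> mA x12.
have m2 x : measurable (`]-oo, x] `*` A) by exact: measurableX.
have m3 : measurable (`]x1, x2] `*` A) by exact: measurableX.
have -> : `]-oo, x2] `*` A = (`]-oo, x1] `*` A) `|` (`]x1, x2] `*` A).
  apply/seteqP; split => z.
    case=> /=; rewrite in_itv/= => zx Az.
    by have [h|h] := leP z.1 x1; [left|right]; split => //=; rewrite in_itv/= ?h.
  case=> -[/=]; rewrite in_itv/=.
    by move=> h Az; split => //=; rewrite in_itv/= (le_trans h).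
  by move=> /andP[_ h] Az; split => //=; rewrite in_itv.
have -> : Q ((`]-oo, x1] `*` A) `|` (`]x1, x2] `*` A)) =
    (Q (`]-oo, x1] `*` A) + Q (`]x1, x2] `*` A))%E.
  apply: measureU => //; apply/seteqP; split => // z [[/=]].
  rewrite !in_itv/= => h _ [/andP[h' _] _].
  by move: h'; rewrite ltNge h.
by rewrite fineD ?fin_num_measure// addrAC subrr add0r.
Qed.

Let itv_slice_integrable (c x1 x2 : R) A : measurable A ->
  mu.-integrable `]x1, x2] (EFin \o (fun x => c * slice g rho A x)).
Proof.
move=> mA; apply: (@integrableS _ _ _ mu `[x1, x2]) => //.
  by move=> x; rewrite /= !in_itv/= => /andP[/ltW-> ->].
apply: continuous_compact_integrable; first exact: segment_compact.
apply: continuous_subspaceT => x; apply: cvgM; first exact: cvg_cst.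
exact: slice_continuous.
Qed.

(** The marginal density has a positive lower bound on every bounded interval. *)
Lemma axis_cdf_lt (x1 x2 : R) : x1 < x2 -> axis_cdf P x1 < axis_cdf P x2.
Proof.
move=> x12; rewrite -subr_gt0 !axis_cdf_law law_strip_diff//; last exact: ltW.
have [c c0 E] := elliptical_law_strip.
rewrite E// -/(Rintegral mu _ _).
have [m m0 h] := slice_total_lower_bound hg rho1 g_nonincreasing g_gt0 g_integrable x1 x2.
apply: (@lt_le_trans _ _ (\int[mu]_(x in `]x1, x2]) (c * m))).
  rewrite Rintegral_cst//= lebesgue_measure_itv/= lte_fin x12 -EFinD/=.
  by rewrite !mulr_gt0// subr_gt0.
apply: le_Rintegral => //.
- apply: (@integrableS _ _ _ mu `[x1, x2]) => //.
    by move=> x; rewrite /= !in_itv/= => /andP[/ltW-> ->].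
  apply: continuous_compact_integrable; first exact: segment_compact.
  by apply: continuous_subspaceT => ?; exact: cvg_cst.
- exact: itv_slice_integrable.
- by move=> x; rewrite /= in_itv/= => /andP[/ltW h1 h2]; rewrite ler_pM2l// h// h1.
Qed.

Hypothesis g_tp2 : forall x x' y y', x <= x' -> y <= y' ->
  g (quad_form rho (x, y')) * g (quad_form rho (x', y)) <=
  g (quad_form rho (x, y)) * g (quad_form rho (x', y')).

(** The joint increment is the integral of the conditional distribution function against the
    marginal density, and the former lies between its values at the end points. *)
Lemma tilted_cdf_increment (x1 x2 y : R) : x1 <= x2 ->
  conditional_cdf g rho y x2 * (axis_cdf P x2 - axis_cdf P x1) <=
    tilted_cdf P rho x2 y - tilted_cdf P rho x1 y <=
  conditional_cdf g rho y x1 * (axis_cdf P x2 - axis_cdf P x1).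
Proof.
move=> x12; set k := conditional_cdf g rho y.
rewrite !axis_cdf_law !tilted_cdf_law !law_strip_diff//.
have [c c0 E] := elliptical_law_strip.
rewrite !E// -/(Rintegral mu _ _) -/(Rintegral mu _ _).
have T0 := slice_total_gt0 hg rho1 g_nonincreasing g_gt0 g_integrable.
have kE x : slice g rho `]-oo, y] x = k x * slice g rho setT x.
  by rewrite /k /conditional_cdf divfK// gt_eqF.
have kmono x x' : x <= x' -> k x' <= k x.
  move=> xx'; exact: (conditional_cdf_nonincreasing hg rho1 g_nonincreasing
    g_gt0 g_integrable g_tp2).
have iT a : mu.-integrable `]x1, x2] (EFin \o (fun x => a * (c * slice g rho setT x))).
  have -> : (fun x => a * (c * slice g rho setT x)) = (fun x => a * c * slice g rho setT x).
    by apply/funext => x; rewrite mulrA.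
  exact: itv_slice_integrable.
rewrite -!RintegralZl//; [|exact: itv_slice_integrable..].
apply/andP; split; apply: le_Rintegral => //; try exact: itv_slice_integrable.
  move=> x; rewrite /= in_itv/= => /andP[/ltW h1 h2].
  by rewrite kE mulrCA ler_pM2l// ler_pM2r// kmono.
move=> x; rewrite /= in_itv/= => /andP[/ltW h1 h2].
by rewrite kE [leRHS]mulrCA ler_pM2l// ler_pM2r// kmono.
Qed.

End ConditionalIncrements.

(** * Decreasing derivatives and the Schur order *)

Section DerivativeFromIncrements.
Context {R : realType}.
Implicit Types (x u t : R).

Variables F k D : R -> R.
Hypothesis F_increasing : forall x x', x < x' -> F x < F x'.
Hypothesis F_surj : forall u, 0 < u < 1 -> exists x, F x = u.
Hypothesis k_nonincreasing : {homo k : x x' /~ x <= x'}.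
Hypothesis k_continuous : continuous k.
Hypothesis D_increment : forall x x', x <= x' ->
  k x' * (F x' - F x) <= D (F x') - D (F x) <= k x * (F x' - F x).

(** An inverse of F by choice; the default 0 is taken where F misses u. *)
Definition quantile u : R := xget 0 [set x | F x = u].

Let quantileK u : 0 < u < 1 -> F (quantile u) = u.
Proof. by move=> /F_surj[x Fx]; rewrite /quantile; case: xgetP => [y _ //|/(_ x)]. Qed.

Let F_ler x x' : F x <= F x' -> x <= x'.
Proof. by apply: contraTT; rewrite -!ltNge => /F_increasing. Qed.

Let F_ltr x x' : F x < F x' -> x < x'.
Proof.
rewrite !ltNge; apply: contra; rewrite le_eqVlt => /predU1P[->//|].
by move=> /F_increasing/ltW.
Qed.

Definition density_at u : R := k (quantile u).

Lemma density_at_nonincreasing s t : 0 < s -> s <= t -> t < 1 ->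
  density_at t <= density_at s.
Proof.
move=> s0 st t1; apply: k_nonincreasing; apply: F_ler.
by rewrite !quantileK ?s0 ?t1 ?(lt_le_trans s0 st) ?(le_lt_trans st t1).
Qed.

(** Strict monotonicity of F makes the quantile continuous: z between the values of F at
    [quantile u - d / 2] and [quantile u + d / 2] has its quantile between these two points. *)
Lemma density_at_continuous u : 0 < u < 1 -> {for u, continuous density_at}.
Proof.
move=> u01; apply/cvgrPdist_lt => e e0.
have /cvgrPdist_lt /(_ _ e0) [d /= d0 H] := @k_continuous (quantile u).
have [u0 u1] := andP u01.
have lo : F (quantile u - d / 2) < u.
  by rewrite -[ltRHS](quantileK u01) F_increasing// gtrBl divr_gt0.
have hi : u < F (quantile u + d / 2).
  by rewrite -[ltLHS](quantileK u01) F_increasing// ltrDl divr_gt0.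
near=> z.
have z01 : 0 < z < 1.
  apply/andP; split; near: z; [exact: lt_nbhsr|exact: lt_nbhsl].
have zlo : F (quantile u - d / 2) < z by near: z; exact: lt_nbhsr.
have zhi : z < F (quantile u + d / 2) by near: z; exact: lt_nbhsl.
apply: H => /=.
have := F_ltr (x := quantile u - d / 2) (x' := quantile z).
rewrite (quantileK z01) => /(_ zlo) h1.
have := F_ltr (x := quantile z) (x' := quantile u + d / 2).
rewrite (quantileK z01) => /(_ zhi) h2.
by rewrite distrC ltr_distl; apply/andP; split; lra.
Unshelve. all: by end_near. Qed.

(** A difference quotient of D lies between the values of [density_at] at its end points, by
    [D_increment] at the quantiles; continuity closes the squeeze. *)
Lemma is_derive_density_at u : 0 < u < 1 -> is_derive u 1 D (density_at u).
Proof.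
move=> u01; apply/is_derive1_caratheodory.
exists (fun z => if z == u then density_at u else (D z - D u) / (z - u)).
rewrite eqxx; split => //.
  move=> z; case: eqVneq => [->|zu]; first by rewrite !subrr mulr0.
  by rewrite divfK// subr_eq0.
have /cvgrPdist_lt cd := density_at_continuous u01.
apply/cvgrPdist_lt => e e0; rewrite eqxx.
have [u0 u1] := andP u01.
have inc s t : 0 < s -> s < t -> t < 1 ->
    density_at t <= (D t - D s) / (t - s) <= density_at s.
  move=> s0 st t1; have s01 : 0 < s < 1 by rewrite s0 (lt_trans st).
  have t01 : 0 < t < 1 by rewrite t1 (lt_trans s0).
  have ts0 : 0 < t - s by rewrite subr_gt0.
  rewrite ler_pdivlMr// ler_pdivrMr//.
  have := @D_increment (quantile s) (quantile t).
  rewrite !quantileK//; apply; apply: F_ler.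
  by rewrite !quantileK// ltW.
near=> z.
have z01 : 0 < z < 1.
  apply/andP; split; near: z; [exact: lt_nbhsr|exact: lt_nbhsl].
have [z0 z1] := andP z01.
have hz : `|density_at u - density_at z| < e by near: z; exact: cd.
have [zu|uz|_] := ltgtP z u; last by rewrite subrr normr0.
  have := inc z u z0 zu u1.
  rewrite -mulrNN -invrN !opprB => /andP[h1 h2].
  apply: le_lt_trans hz; rewrite !ler0_norm ?subr_le0//; last exact: le_trans h2.
  by rewrite lerN2 lerB.
have /andP[h1 h2] := inc u z u0 uz z1.
apply: le_lt_trans hz; rewrite !ger0_norm ?subr_ge0//; last exact: le_trans h2.
by rewrite lerB.
Unshelve. all: by end_near. Qed.

End DerivativeFromIncrements.

(** * Rearrangements of derivatives and their primitives *)

Section SchurOrder.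
Context {R : realType}.
Local Notation mu := (@lebesgue_measure R).
Implicit Types (f h D : R -> R) (p s t w x : R).

(** Meant for a derivative with an unspecified value at p: it differs from h by a multiple of the
    indicator of p. *)
Lemma measurable_off_point f h p : measurable_fun (`]0, 1[ : set R) h ->
  (forall t, 0 < t < 1 -> t != p -> f t = h t) -> measurable_fun (`]0, 1[ : set R) f.
Proof.
move=> mh fh.
apply: (eq_measurable_fun (fun t => h t + (f p - h p) * \1_[set p] t)).
  move=> t; rewrite inE/= in_itv/= => t01; rewrite indicE.
  have [->|tp] := eqVneq t p; first by rewrite mem_set// mulr1 subrKC.
  by rewrite memNset ?mulr0 ?addr0 ?fh// => tp'; move: tp; rewrite tp' eqxx.
by apply: measurable_funD => //; apply: measurable_funM.
Qed.

Lemma level_set_measurable f w : measurable_fun (`]0, 1[ : set R) f ->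
  measurable (`]0, 1[ `&` [set t | w <= f t]).
Proof.
move=> mf; have := mf (measurable_itv _) _ (measurable_itv `[w, +oo[).
by congr measurable; apply/seteqP; split => t [t01]; rewrite /= in_itv/= ?andbT => h;
  split => //; rewrite /= in_itv/= andbT.
Qed.

Lemma level_set_off_point f h p w : measurable_fun (`]0, 1[ : set R) h ->
  (forall t, 0 < t < 1 -> t != p -> f t = h t) ->
  mu (`]0, 1[ `&` [set t | w <= f t]) = mu (`]0, 1[ `&` [set t | w <= h t]).
Proof.
move=> mh fh; have mf := measurable_off_point mh fh.
have le (u v : R -> R) :
    measurable_fun (`]0, 1[ : set R) u -> measurable_fun (`]0, 1[ : set R) v ->
    (forall t, 0 < t < 1 -> t != p -> u t = v t) ->
    (mu (`]0%R, 1%R[ `&` [set t | (w <= u t)%R]) <=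
     mu (`]0%R, 1%R[ `&` [set t | (w <= v t)%R]))%E.
  move=> mu' mv uv.
  have mV := level_set_measurable w mv.
  apply: (@le_trans _ _ (mu ((`]0%R, 1%R[ `&` [set t | (w <= v t)%R]) `|` [set p]))%E).
    apply: le_measure; rewrite ?inE.
    - exact: level_set_measurable.
    - exact: measurableU.
    move=> t [t01 wt]; have [tp|tp] := eqVneq t p; first by right.
    by left; split => //=; rewrite -uv.
  apply: (le_trans (measureU2 _ _ _)) => //.
  by rewrite [X in (_ + X)%E]lebesgue_measure_set1 adde0.
apply/eqP; rewrite eq_le !le// => t t01 tp; by rewrite fh.
Qed.

Lemma level_set_onem h w : measurable_fun (`]0, 1[ : set R) h ->
  mu (`]0, 1[ `&` [set t | w <= h (1 - t)]) = mu (`]0, 1[ `&` [set t | w <= h t]).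
Proof.
move=> mh; have mH := level_set_measurable w mh.
have N0 : -1 != 0 :> R by rewrite oppr_eq0 oner_eq0.
rewrite [RHS](lebesgue_measure_affine 1 N0 mH) normrN1 mul1e.
congr (mu _); apply/seteqP; split => t; rewrite /= !in_itv/= mulN1r [- t + 1]addrC;
  by move=> [/andP[t0 t1] wt]; split => //; apply/andP; split; lra.
Qed.

Lemma measurable_onem h : measurable_fun (`]0, 1[ : set R) h ->
  measurable_fun (`]0, 1[ : set R) (fun t => h (1 - t)).
Proof.
move=> mh; apply: (measurable_comp (measurable_itv _) _ mh).
  by move=> _ [t /= + <-]; rewrite !in_itv/= => /andP[? ?]; apply/andP; split; lra.
exact: measurable_funB.
Qed.

Lemma integrable_unit_bounded (i : interval R) f : [set` i] `<=` `]0, 1[ ->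
  measurable_fun (`]0, 1[ : set R) f -> (exists M : R, forall t, 0 < t < 1 -> `|f t| <= M) ->
  mu.-integrable [set` i] (EFin \o f).
Proof.
move=> i01 mf [M fM]; apply: (@integrableS _ _ _ mu `]0, 1[) => //.
apply: (@le_integrable _ _ _ mu _ _ _ (EFin \o cst M)) => //.
- exact/measurable_EFinP.
- move=> t; rewrite /= in_itv/= => t01; rewrite lee_fin (le_trans (fM _ t01))//.
  exact: ler_norm.
apply: (@integrableS _ _ _ mu `[0, 1]) => //; first exact: subset_itv_oo_cc.
apply: continuous_compact_integrable; first exact: segment_compact.
by apply: continuous_subspaceT => ?; exact: cvg_cst.
Qed.

(* D is the primitive of the decreasing function h, except that D need not be
   differentiable at p. *)
Definition decreasing_derivative D h p : Prop :=
  [/\ measurable_fun (`]0, 1[ : set R) h,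
      forall s t, 0 < s -> s <= t -> t < 1 -> h t <= h s,
      forall t, 0 < t < 1 -> 0 <= h t <= 1,
      forall t, 0 < t < 1 -> t != p -> is_derive t 1 D (h t)
    & forall x, 0 < x <= 1 -> (\int[mu]_(t in `]0%R, x[) (h t)%:E)%E = (D x)%:E].

Lemma is_derive_near_eq f1 f2 t (df : R) : {near t, f1 =1 f2} ->
  is_derive t 1 f1 df -> is_derive t 1 f2 df.
Proof.
move=> f12 [d1 e1].
split; first exact: near_eq_derivable d1.
by rewrite -e1; apply/esym/near_eq_derive.
Qed.

Lemma is_derive_unit_itv f1 f2 t (df : R) : 0 < t < 1 ->
  (forall s, 0 < s < 1 -> f1 s = f2 s) ->
  is_derive t 1 f1 df -> is_derive t 1 f2 df.
Proof.
move=> /andP[t0 t1] f12; apply: is_derive_near_eq; near=> z; apply: f12.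
by apply/andP; split; near: z; [exact: lt_nbhsr|exact: lt_nbhsl].
Unshelve. all: by end_near. Qed.

Definition derivative_rearrangement D h : Prop :=
  mu.-integrable `]0, 1[ (EFin \o derive1 D) /\
  is_decreasing_rearrangement (derive1 D) h.

Lemma decreasing_derivative_rearrangement D E h p :
  decreasing_derivative D h p -> (forall t, 0 < t < 1 -> D t = E t) ->
  derivative_rearrangement E h.
Proof.
move=> [mh h_dec h01 Dh _] DE.
have eqE t : 0 < t < 1 -> t != p -> derive1 E t = h t.
  move=> t01 tp; rewrite derive1E.
  by have [_ ->] := is_derive_unit_itv t01 DE (Dh t t01 tp).
split; last by split => // w; rewrite (level_set_off_point w mh eqE).
apply: integrable_unit_bounded => //; first exact: measurable_off_point eqE.
exists (1 + `|derive1 E p|) => t t01; have [->|tp] := eqVneq t p.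
  by rewrite lerDr.
rewrite eqE//; have /andP[h0 h1] := h01 _ t01.
by rewrite ger0_norm// (le_trans h1)// lerDl.
Qed.

(** The case of negative correlation: the derivative of E is h(1 - t), which increases but has the
    same level-set measures as h. *)
Lemma decreasing_derivative_onem D E h p (v : R) : decreasing_derivative D h p ->
  (forall t, 0 < t < 1 -> E t = v - D (1 - t)) -> derivative_rearrangement E h.
Proof.
move=> [mh h_dec h01 Dh _] ED.
have eqE t : 0 < t < 1 -> t != 1 - p -> derive1 E t = h (1 - t).
  move=> t01 tp.
  have t01' : 0 < 1 - t < 1 by lra.
  have tp' : 1 - t != p by apply: contra_neq tp => <-; rewrite opprB subrKC.
  have Dt := Dh _ t01' tp'.
  have D1 : is_derive t 1 (fun t : R => 1 - t) (- 1).
    apply/is_derive1_caratheodory; exists (fun=> - 1); split => //.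
      by move=> z; ring.
    exact: cvg_cst.
  have D2 := is_derive1_comp (f := D) (g := fun t : R => 1 - t) Dt D1.
  have D3 : is_derive t 1 (fun t : R => v - (D \o (fun t => 1 - t)) t) (0 - h (1 - t) * -1).
    exact: is_deriveB.
  have DE s : 0 < s < 1 -> v - (D \o (fun t => 1 - t)) s = E s by move=> s01; rewrite ED.
  rewrite derive1E; have [_ ->] := is_derive_unit_itv t01 DE D3.
  by rewrite sub0r mulrN1 opprK.
have mh' := measurable_onem mh.
split.
  apply: integrable_unit_bounded => //; first exact: measurable_off_point eqE.
  exists (1 + `|derive1 E (1 - p)|) => t t01; have [->|tp] := eqVneq t (1 - p).
    by rewrite lerDr.
  have t01' : 0 < 1 - t < 1 by lra.
  rewrite eqE//; have /andP[h0 h1] := h01 _ t01'.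
  by rewrite ger0_norm// (le_trans h1)// lerDl.
by split => // w; rewrite (level_set_off_point w mh' eqE) level_set_onem.
Qed.

(** The functions f1 and f2 carry the given correlations, D1 and D2 their absolute values; they meet
    only through the common rearrangements h1 and h2. *)
Lemma schur_le_primitive f1 f2 D1 D2 h1 h2 p1 p2 :
  derivative_rearrangement f1 h1 -> derivative_rearrangement f2 h2 ->
  decreasing_derivative D1 h1 p1 -> decreasing_derivative D2 h2 p2 ->
  (forall t, 0 < t < 1 -> D1 t <= D2 t) -> D1 1 = D2 1 ->
  schur_le (derive1 f1) (derive1 f2).
Proof.
move=> [i1 r1] [i2 r2] [_ _ _ _ I1] [_ _ _ _ I2] D12 D1E; split => //.
exists h1, h2; split => //; last by rewrite I1 ?I2 ?D1E ?ltr01 ?lexx.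
move=> x x0 x1; have x01 : 0 < x <= 1 by rewrite x0 ltW.
by rewrite I1// I2// lee_fin D12// x0.
Qed.

(** As h need not be continuous at 0 and 1, the fundamental theorem is applied on [d, b - d]. On
    both end pieces the integral and the increment of D lie between 0 and d. *)
Lemma integral_derivative D h (b : R) : 0 < b <= 1 ->
  (forall s t, 0 <= s -> s <= t -> t <= 1 -> 0 <= D t - D s <= t - s) -> D 0 = 0 ->
  (forall t, 0 < t < 1 -> {for t, continuous h}) ->
  (forall t, 0 < t < 1 -> 0 <= h t <= 1) ->
  (forall t, 0 < t < 1 -> is_derive t 1 D (h t)) ->
  measurable_fun (`]0, 1[ : set R) h ->
  (\int[mu]_(t in `]0%R, b[) (h t)%:E)%E = (D b)%:E.
Proof.
move=> /andP[b0 b1] Dlip D0 ch h01 Dh mh.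
have ih (i : interval R) : [set` i] `<=` `]0, 1[ -> mu.-integrable [set` i] (EFin \o h).
  move=> i01; apply: integrable_unit_bounded => //; exists 1 => t t01.
  by have /andP[h0 h1] := h01 t t01; rewrite ger0_norm.
suff E : \int[mu]_(t in `]0, b[) h t = D b.
  have ib : [set` `]0, b[] `<=` (`]0, 1[ : set R) by apply: subset_itvl; rewrite bnd_simp.
  by rewrite -E /Rintegral fineK//; apply: integrable_fin_num => //; exact: (ih _ ib).
apply/eqP; rewrite -subr_eq0 -normr_le0; apply/ler_addgt0Pr => e e0; rewrite add0r.
(* The total error is at most 2 d, hence e / 2; the bound b / 3 ensures d < b - d. *)
pose d := Num.min (e / 2) (b / 3).
have d0 : 0 < d by rewrite lt_min !divr_gt0.
have de : d <= e / 2 by rewrite ge_min lexx.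
have db : d <= b / 3 by rewrite ge_min lexx orbT.
have bound (bl br : bool) (u v : R) : [set` Interval (BSide bl u) (BSide br v)] `<=` `]0, 1[ ->
   u < v -> 0 <= \int[mu]_(t in [set` Interval (BSide bl u) (BSide br v)]) h t <= v - u.
  move=> i01 uv; apply/andP; split.
    by apply: Rintegral_ge0 => t /i01; rewrite /= in_itv/= => /h01/andP[].
  have -> : v - u = \int[mu]_(t in [set` Interval (BSide bl u) (BSide br v)]) 1.
    by rewrite Rintegral_cst//= lebesgue_measure_itv/= lte_fin uv mul1r.
  apply: le_Rintegral => //; first exact: ih.
    by apply: integrable_unit_bounded => //; exists 1 => t _; rewrite normr1.
  by move=> t /i01; rewrite /= in_itv/= => /h01/andP[].
have s1 : [set` `]0, d[] `<=` (`]0, 1[%classic : set R).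
  by move=> t; rewrite /= !in_itv/= => /andP[? ?]; apply/andP; split; lra.
have s2 : [set` `]b - d, b[] `<=` (`]0, 1[%classic : set R).
  by move=> t; rewrite /= !in_itv/= => /andP[? ?]; apply/andP; split; lra.
have bd : b - d < b by lra.
have d1 : 0 <= D d - D 0 <= d - 0 by apply: Dlip; lra.
have d2 : 0 <= D b - D (b - d) <= b - (b - d) by apply: Dlip; lra.
have mid : \int[mu]_(t in `[d, b - d]) h t = D (b - d) - D d.
  have in01 t : d <= t <= b - d -> 0 < t < 1 by move=> ?; lra.
  rewrite /Rintegral (@continuous_FTC2 _ h D)//.
  - by lra.
  - apply: continuous_in_subspaceT => t; rewrite inE/= in_itv/= => /in01; exact: ch.
  - have cD t : 0 < t < 1 -> D x @[x --> t] --> D t.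
      move=> /Dh[dD _]; exact/differentiable_continuous/derivable1_diffP.
    split.
    + by move=> t; rewrite in_itv/= => tin; have [|] := Dh t; first lra.
    + by apply: cvg_at_right_filter; apply: cD; lra.
    + by apply: cvg_at_left_filter; apply: cD; lra.
  - by move=> t; rewrite in_itv/= => tin; rewrite derive1E; have [|] := Dh t; first lra.
have spl : \int[mu]_(t in `]0, b[) h t = \int[mu]_(t in `]0, d[) h t +
    (\int[mu]_(t in `[d, b - d]) h t + \int[mu]_(t in `]b - d, b[) h t).
  have e1 : `]0, b[%classic = `]0, d[%classic `|` `[d, b[%classic :> set R.
    apply/seteqP; split => t; rewrite /= !in_itv/=.
      by move=> /andP[t0 tb]; have [dt|td] := leP d t; [right|left]; apply/andP.
    by case=> /andP[? ?]; apply/andP; split; lra.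
  have e2 : `[d, b[%classic = `[d, b - d]%classic `|` `]b - d, b[%classic :> set R.
    apply/seteqP; split => t; rewrite /= !in_itv/=.
      by move=> /andP[dt tb]; have [bt|tb'] := leP t (b - d); [left|right]; apply/andP.
    by case=> /andP[? ?]; apply/andP; split; lra.
  have i2 : mu.-integrable `[d, b[ (EFin \o h).
    by apply: ih => t; rewrite /= !in_itv/= => /andP[? ?]; apply/andP; split; lra.
  have i1 : mu.-integrable `]0, b[ (EFin \o h).
    by apply: ih; apply: subset_itvl; rewrite bnd_simp.
  rewrite e1 Rintegral_setU//; last 2 first.
  - by rewrite -e1.
  - rewrite disj_set2E; apply/eqP/seteqP; split => // t /=.
    by rewrite !in_itv/= => -[/andP[_ td] /andP[dt _]]; lra.
  congr (_ + _); rewrite e2 Rintegral_setU//; first by rewrite -e2.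
  rewrite disj_set2E; apply/eqP/seteqP; split => // t /=.
  by rewrite !in_itv/= => -[/andP[_ td] /andP[dt _]]; lra.
rewrite spl mid ler_norml; move: (bound _ _ _ _ s1 d0) (bound _ _ _ _ s2 bd) {spl mid}.
move: (\int[mu]_(t in `]0, d[) h t) (\int[mu]_(t in `]b - d, b[) h t) => I1 I3.
by move=> {bound} b1' b2'; lra.
Qed.

End SchurOrder.

(** * Consequences of the elasticity bounds *)

Section RegularGenerator.
Context {R : realType}.
Implicit Types (x y s t u v : R).

Variables (g : R -> R).
Let phi : R -> R := fun t => ln (g t).
Let psi := derive_Rplus phi.
Hypothesis g_gt0 : forall t, 0 <= t -> 0 < g t.
Hypotheses (dphi : derivable_Rplus phi) (dpsi : derivable_Rplus psi).

Let g_exp t : 0 <= t -> g t = expR (phi t).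
Proof. by move=> t0; rewrite /phi lnK// posrE g_gt0. Qed.

Lemma generator_continuous : continuous (fun t => g `|t|).
Proof.
have -> : (fun t => g `|t|) = expR \o (fun t => phi `|t|).
  by apply/funext => t /=; rewrite g_exp.
move=> t; apply: continuous_comp; first exact: derivable_Rplus_continuous.
exact: continuous_expR.
Qed.

Lemma generator_nonincreasing : (forall t, 0 < t -> psi t < 0) ->
  forall s t, 0 <= s -> s <= t -> g t <= g s.
Proof.
move=> psi_lt0 s t s0 st; have t0 : 0 <= t by apply: le_trans st.
rewrite !g_exp// ler_expR -lerN2.
have := @is_derive_ge0_le R (fun t => - phi `|t|) (fun t => - psi t) s t st.
rewrite !ger0_norm//; apply.
- apply: continuous_subspaceT => z; apply: cvgN.
  exact: derivable_Rplus_continuous.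
- move=> z /andP[sz _]; have z0 : 0 < z by apply: le_lt_trans sz.
  have D : is_derive z 1 (fun t => - phi t) (- psi z).
    by have := derivable_Rplus_is_derive dphi z0; exact: is_deriveN.
  apply: is_derive_near_eq D; near=> w; rewrite gtr0_norm//.
  by near: w; exact: lt_nbhsr.
- move=> z /andP[sz _]; rewrite oppr_ge0 ltW// psi_lt0//.
  exact: le_lt_trans sz.
Unshelve. all: by end_near. Qed.

Lemma generator_tp2 rho : 0 <= rho < 1 -> (forall t, 0 < t -> psi t < 0) ->
  (forall t, 0 < t ->
    - (rho / (1 + rho)) <= t * derive_Rplus psi t / psi t <= rho / (1 - rho)) ->
  forall x x' y y', x <= x' -> y <= y' ->
  g (quad_form rho (x, y')) * g (quad_form rho (x', y)) <=
  g (quad_form rho (x, y)) * g (quad_form rho (x', y')).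
Proof.
move=> r01 psi_lt0 el x x' y y' xx' yy'.
have rho1 : -1 < rho < 1 by lra.
rewrite !g_exp ?quad_form_ge0// -!expRD ler_expR.
exact: generator_supermodular.
Qed.

(** Both r / (1 + r) and r / (1 - r) increase with r, so a hypothesis at one correlation covers the
    larger ones. *)
Lemma elasticity_widen (r rho k : R) : 0 <= r -> r <= rho -> rho < 1 ->
  - (r / (1 + r)) <= k <= r / (1 - r) ->
  - (rho / (1 + rho)) <= k <= rho / (1 - rho).
Proof.
move=> r0 rr r1 /andP[k1 k2]; apply/andP; split.
  apply: le_trans k1; rewrite lerN2 ler_pdivrMr; last lra.
  by rewrite mulrAC ler_pdivlMr; [nra|lra].
apply: (le_trans k2); rewrite ler_pdivrMr; last lra.
by rewrite mulrAC ler_pdivlMr; [nra|lra].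
Qed.

Lemma generator_elasticity (r : R) :
  let T : set R := [set t : R | 0 <= t /\ psi t < 0] in
  let q : R -> \bar R := fun t => (t * derive_Rplus psi t / psi t)%:E in
  0 <= r < 1 ->
  ((- (r / (1 + r)))%:E <= ereal_inf (q @` T))%E ->
  (ereal_inf (q @` T) <= ereal_sup (q @` T))%E ->
  (ereal_sup (q @` T) <= (r / (1 - r))%:E)%E ->
  (forall t, 0 < t -> psi t < 0) /\
  (forall t, 0 < t ->
    - (r / (1 + r)) <= t * derive_Rplus psi t / psi t <= r / (1 - r)).
Proof.
move=> T q /andP[r0 r1] qinf qis qsup.
have el t : 0 <= t -> psi t < 0 ->
    - (r / (1 + r)) <= t * derive_Rplus psi t / psi t <= r / (1 - r).
  move=> t0 pt; have Tt : (q @` T) (q t) by exists t.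
  rewrite -!lee_fin; apply/andP; split.
    exact: le_trans qinf (ereal_inf_lbound Tt).
  exact: le_trans (ereal_sup_ubound Tt) qsup.
suff neg t : 0 < t -> psi t < 0.
  by split => // t t0; apply: el; [exact: ltW|exact: neg].
(* For empty T the infimum is +oo and the supremum -oo, against [qis]. *)
have [t0 Tt0] : T !=set0.
  apply/set0P/eqP => T0; move: qis; rewrite T0 image_set0 ereal_inf0 ereal_sup0.
  by [].
(* If the point found in T is 0, continuity of psi at 0 provides a positive one. *)
have [a a0 pa] : exists2 a, 0 < a & psi a < 0.
  case: Tt0 => t0_ge0 pt0; have [t0_0|t0_gt] := eqVneq t0 0; last first.
    by exists t0 => //; rewrite lt_neqAle eq_sym t0_gt.
  have cpsi := @derivable_Rplus_continuous _ psi dpsi 0.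
  have h0 : psi `|0 : R| < 0 by move: pt0; rewrite t0_0 (ger0_norm (lexx 0)).
  have [d /= d0 H] := cvgr_lt _ cpsi 0 h0.
  exists (d / 2); first by rewrite divr_gt0.
  have := H (d / 2); rewrite /= sub0r normrN gtr0_norm ?divr_gt0//; apply.
  by rewrite gtr_pMr// invf_lt1// ltr1n.
(* A natural bound for both sides, as r / (1 + r) <= r / (1 - r). *)
pose n := Num.truncn (r / (1 - r)).
have hn : r / (1 - r) <= n.+1%:R.
  by apply/ltW; rewrite truncnS_gt.
apply: (elasticity_bounded_lt0 (n := n) dpsi a0 pa) => s s0 ps.
have /andP[e1 e2] := el s (ltW s0) ps.
rewrite ler_norml (le_trans e2 hn) andbT; apply: le_trans e1.
rewrite lerN2; apply: le_trans hn; rewrite ler_pdivrMr; last lra.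
by rewrite mulrAC ler_pdivlMr; [nra|lra].
Qed.

End RegularGenerator.

(** * Derivatives of elliptical copulas *)

Section EllipticalSchur.
Context {R : realType}.
Local Notation mu := (@lebesgue_measure R).
Implicit Types (g : R -> R) (C : R -> R -> R -> R) (rho u v t : R).

Lemma copula_increment (D : R -> R -> R) s t v : is_copula D ->
  0 <= v <= 1 -> 0 <= s -> s <= t -> t <= 1 -> 0 <= D t v - D s v <= t - s.
Proof.
move=> [_ gD mD iD] v01 s0 st t1; have [v0 v1] := andP v01.
have s01 : 0 <= s <= 1 by rewrite s0 (le_trans st).
have t01 : 0 <= t <= 1 by rewrite t1 (le_trans s0).
have [Ds0 _] := gD _ s01; have [Dt0 _] := gD _ t01.
have [Ds1 _] := mD _ s01; have [Dt1 _] := mD _ t01.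
have h1 := iD s t 0 v s0 st t1 (lexx _) v0 v1.
have h2 := iD s t v 1 s0 st t1 v0 v1 (lexx _).
by apply/andP; split; lra.
Qed.

Lemma elliptical_copulaC g C rho u v : density_generator g ->
  elliptical_copula_family g C -> -1 <= rho <= 1 -> 0 < u < 1 -> 0 < v < 1 ->
  C rho u v = C rho v u.
Proof.
move=> hg hC r1 u01 v01.
have u01' : 0 <= u <= 1 by lra.
have v01' : 0 <= v <= 1 by lra.
have [_ hC1 hCN1] := hC; have [P hP] := elliptical_family_spherical hC.
have [->|rN1] := eqVneq rho (-1); first by rewrite !hCN1// [u + v]addrC.
have [->|r1'] := eqVneq rho 1; first by rewrite !hC1// minC.
have {}r1 : -1 < rho < 1 by move: r1; rewrite !le_eqVlt eq_sym (negbTE rN1) (negbTE r1').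
have [x <-] := axis_cdf_surj hg hP u01; have [y <-] := axis_cdf_surj hg hP v01.
by rewrite !(sklar_tilted _ _ hg hC hP)// (tilted_cdfC _ _ hg hP).
Qed.

Lemma elliptical_copulaN g C rho u v : density_generator g ->
  elliptical_copula_family g C -> -1 <= rho <= 1 -> 0 < u < 1 -> 0 < v < 1 ->
  C (- rho) u v = v - C rho (1 - u) v.
Proof.
move=> hg hC r1 u01 v01.
have u01' : 0 <= u <= 1 by lra.
have nu01 : 0 <= 1 - u <= 1 by lra.
have v01' : 0 <= v <= 1 by lra.
have [_ hC1 hCN1] := hC; have [P hP] := elliptical_family_spherical hC.
have [->|rN1] := eqVneq rho (-1).
  by rewrite opprK hC1// hCN1// minEle maxEle; case: leP => ?; case: leP => ?; lra.
have [->|r1'] := eqVneq rho 1.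
  by rewrite hC1// hCN1// minEle maxEle; case: leP => ?; case: leP => ?; lra.
have {}r1 : -1 < rho < 1 by move: r1; rewrite !le_eqVlt eq_sym (negbTE rN1) (negbTE r1').
have r2 : -1 < - rho < 1 by lra.
have [x <-] := axis_cdf_surj hg hP u01; have [y <-] := axis_cdf_surj hg hP v01.
by rewrite -(axis_cdfN _ hg hP) !(sklar_tilted _ _ hg hC hP)// (tilted_cdfN _ _ hg hP).
Qed.

(** The kink of min(t, v) at t = v is the reason for the exceptional point in
    [decreasing_derivative]. *)
Lemma comonotone_decreasing_derivative (D : R -> R) v : 0 < v < 1 ->
  (forall t, 0 <= t <= 1 -> D t = Num.min t v) ->
  decreasing_derivative D (\1_(`]-oo, v])) v.
Proof.
move=> /andP[v0 v1] DE.
have hE t : \1_(`]-oo, v]) t = (if t <= v then 1 else 0) :> R.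
  by rewrite indicE mem_setE in_itv/=; case: ifP.
split.
- exact: measurable_indic.
- move=> s t s0 st t1; rewrite !hE.
  have [tv|tv] := leP t v; first by rewrite (le_trans st).
  by case: ifP.
- by move=> t _; rewrite hE; case: ifP => _; rewrite lexx ler01.
- move=> t t01 tv.
  have Dm s : 0 < s < 1 -> Num.min s v = D s.
    by move=> /andP[s0 s1]; rewrite DE// !ltW.
  apply: (is_derive_unit_itv t01 Dm); rewrite hE.
  have [tlev|vt] := leP t v.
    have {tv}tv : t < v by rewrite lt_neqAle tv.
    apply: (@is_derive_near_eq _ id).
    near=> z; rewrite min_l// ltW//; near: z; exact: lt_nbhsl.
  apply: (@is_derive_near_eq _ (cst v)).
  near=> z; rewrite min_r// ltW//; near: z; exact: lt_nbhsr.
- move=> x /andP[x0 x1]; rewrite integral_indic//= DE ?(ltW x0)//.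
  have [xv|vx] := leP x v.
    have -> : `]-oo, v] `&` `]0, x[ = `]0, x[%classic.
      apply/seteqP; split => t /=; rewrite !in_itv/=; first by case.
      by move=> /andP[t0 tx]; rewrite t0 tx (le_trans (ltW tx)).
    by rewrite lebesgue_measure_itv/= lte_fin x0 oppr0 adde0.
  have -> : `]-oo, v] `&` `]0, x[ = `]0, v]%classic.
    apply/seteqP; split => t /=; rewrite !in_itv/=; first by case=> -> /andP[->].
    by move=> /andP[t0 tv]; rewrite t0 tv (le_lt_trans tv).
  by rewrite lebesgue_measure_itv/= lte_fin v0 oppr0 adde0.
Unshelve. all: by end_near. Qed.

(** The derivative is the conditional distribution function read at the quantile. The exceptional
    point 0 lies outside ]0, 1[: a nondegenerate copula is differentiable throughout. *)
Lemma elliptical_decreasing_derivative g C rho v : density_generator g ->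
  elliptical_copula_family g C -> -1 < rho < 1 ->
  (forall t, 0 <= t -> 0 < g t) -> continuous (fun t => g `|t|) ->
  (forall s t, 0 <= s -> s <= t -> g t <= g s) ->
  (forall x x' y y', x <= x' -> y <= y' ->
    g (quad_form rho (x, y')) * g (quad_form rho (x', y)) <=
    g (quad_form rho (x, y)) * g (quad_form rho (x', y'))) ->
  0 < v < 1 ->
  exists h, decreasing_derivative (fun t => C rho t v) h 0.
Proof.
move=> hg hC r1 g_gt0 g_cont g_dec g_tp2 v01.
have [P hP] := elliptical_family_spherical hC.
have [rN1 r1'] := andP r1.
have [Q hQ [cC _]] := (let: And3 h _ _ := hC in h) rho rN1 r1'.
have g_int := integrable_generator_sqr hg hP g_dec.
have [y Fy] := axis_cdf_surj hg hP v01.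
have v01' : 0 <= v <= 1 by lra.
pose k := conditional_cdf g rho y; pose D t := C rho t v.
have F_inc := axis_cdf_lt hg r1 hP hQ g_dec g_gt0 g_cont.
have F_surj u : 0 < u < 1 -> exists x, axis_cdf P x = u.
  exact: axis_cdf_surj hg hP.
have k_mono : {homo k : x x' /~ x <= x'}.
  exact: conditional_cdf_nonincreasing hg r1 g_dec g_gt0 g_int g_tp2 y.
have k_cont : continuous k.
  exact: conditional_cdf_continuous hg r1 g_dec g_gt0 g_cont g_int y.
have D_inc x x' : x <= x' -> k x' * (axis_cdf P x' - axis_cdf P x) <=
    D (axis_cdf P x') - D (axis_cdf P x) <= k x * (axis_cdf P x' - axis_cdf P x).
  move=> xx'; rewrite /D -Fy !(sklar_tilted _ _ hg hC hP)//.
  exact: (tilted_cdf_increment hg r1 hP hQ g_dec g_gt0 g_cont g_tp2).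
have k01 x : 0 <= k x <= 1.
  have T0 := slice_total_gt0 hg r1 g_dec g_gt0 g_int x.
  have S0 A : 0 <= slice g rho A x by apply: slice_ge0 => //.
  rewrite /k /conditional_cdf divr_ge0 ?S0//= ler_pdivrMr// mul1r.
  by rewrite (slice_split hg r1 g_dec g_int _ y) lerDl S0.
pose h := density_at (axis_cdf P) k.
have h_cont t : 0 < t < 1 -> {for t, continuous h}.
  by move=> t01; exact: (density_at_continuous F_inc F_surj k_cont t01).
have Dh t : 0 < t < 1 -> is_derive t 1 D (h t).
  by move=> t01; exact: (is_derive_density_at F_inc F_surj k_cont D_inc t01).
have mh : measurable_fun (`]0, 1[ : set R) h.
  apply: open_continuous_measurable_fun; first exact: interval_open.
  by move=> t; rewrite inE/= in_itv; exact: h_cont.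
exists h; split => //.
- by move=> s t s0 st t1; apply: (density_at_nonincreasing F_inc F_surj k_mono).
- by move=> t _; exact: k01.
- by move=> t t01 _; exact: Dh.
- move=> x x01; apply: (integral_derivative x01 _ _ h_cont _ Dh mh).
  + by move=> s t s0 st t1; exact: copula_increment.
  + by have [_ gC _ _] := cC; have [] := gC v v01'.
  + by move=> t _; exact: k01.
Qed.

(** The sign of rho is removed by [elliptical_copulaN], and the second component is reduced to the
    first by the symmetry of the copula. *)
Lemma elliptical_derivative_rearrangement g C rho v h p : density_generator g ->
  elliptical_copula_family g C -> -1 <= rho <= 1 -> 0 < v < 1 ->
  decreasing_derivative (fun t => C `|rho| t v) h p ->
  derivative_rearrangement (fun t => C rho t v) h /\
  derivative_rearrangement (fun t => C rho v t) h.
Proof.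
move=> hg hC r1 v01 Dh; have [r0|/ltW r0] := leP 0 rho.
  rewrite ger0_norm// in Dh; split.
    exact: (decreasing_derivative_rearrangement Dh).
  apply: (decreasing_derivative_rearrangement Dh) => t t01.
  exact: (elliptical_copulaC hg hC).
rewrite ler0_norm// in Dh.
have r1' : -1 <= - rho <= 1 by lra.
have E t : 0 < t < 1 -> C rho t v = v - C (- rho) (1 - t) v.
  by move=> t01; have := elliptical_copulaN hg hC r1' t01 v01; rewrite opprK.
split; apply: (decreasing_derivative_onem Dh (v := v)) => // t t01.
by rewrite -E// (elliptical_copulaC hg hC).
Qed.

End EllipticalSchur.

Theorem proposition3p6 (R : realType) (g : R -> R) (C : R -> R -> R -> R)
    (hg : density_generator g) (hC : elliptical_copula_family g C)
    (rho rho' : R) (hrho : -1 <= rho <= 1) (hrho' : -1 <= rho' <= 1) :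
  (rho <= rho' <-> lower_orthant_le (C rho) (C rho'))
  /\
  (let phi : R -> R := fun t => ln (g t) in
   let dphi : R -> R := derive_Rplus phi in
   let ddphi : R -> R := derive_Rplus dphi in
   let T : set R := [set t : R | 0 <= t /\ dphi t < 0] in
   let q : R -> \bar R := fun t => (t * ddphi t / dphi t)%:E in
   `|rho| < 1 ->
   (forall t : R, 0 <= t -> 0 < g t) ->
   derivable_Rplus phi -> derivable_Rplus dphi ->
   ((- (`|rho| / (1 + `|rho|)))%:E <= ereal_inf (q @` T))%E ->
   (ereal_inf (q @` T) <= ereal_sup (q @` T))%E ->
   (ereal_sup (q @` T) <= (`|rho| / (1 - `|rho|))%:E)%E ->
   (forall t : R, 0 <= t -> dphi t = 0 -> ddphi t = 0) ->
   `|rho| <= `|rho'| ->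
   schur_le_d (C rho) (C rho')).
Proof.
split; first exact: (elliptical_copula_leP hg hC).
move=> phi dphi ddphi T q r1 g_gt0 d1 d2 qinf qis qsup _ rr'.
have r01 : 0 <= `|rho| < 1 by rewrite normr_ge0.
have [dphi_lt0 el] := generator_elasticity d2 r01 qinf qis qsup.
have g_cont := generator_continuous g_gt0 d1.
have g_dec := generator_nonincreasing g_gt0 d1 dphi_lt0.
have r'1 : -1 <= `|rho'| <= 1.
  by rewrite ler_norml hrho' andbT; apply: le_trans (normr_ge0 _); lra.
have r1' : -1 <= `|rho| <= 1 by have := normr_ge0 rho; lra.
(* This range contains both |rho| and |rho'|; the end point s = 1 occurs when |rho'| = 1. *)
have dec s v : `|rho| <= s <= 1 -> 0 < v < 1 ->
    exists h p, decreasing_derivative (fun t => C s t v) h p.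
  move=> /andP[rs]; rewrite le_eqVlt => /predU1P[->|s1] v01.
    exists (\1_(`]-oo, v])), v; apply: comonotone_decreasing_derivative => // t t01.
    by have [_ hC1 _] := hC; rewrite hC1//; lra.
  have s01 : 0 <= s < 1 by rewrite s1 (le_trans _ rs).
  have [||h hh] := @elliptical_decreasing_derivative R g C s v hg hC _ g_gt0 g_cont g_dec _ v01.
  - by lra.
  - apply: generator_tp2 => // t t0.
    exact: elasticity_widen (normr_ge0 rho) rs s1 (el t t0).
  - by exists h, 0.
have key v : 0 < v < 1 -> exists h1 p1 h2 p2,
   [/\ decreasing_derivative (fun t => C `|rho| t v) h1 p1,
       decreasing_derivative (fun t => C `|rho'| t v) h2 p2,
       forall t, 0 < t < 1 -> C `|rho| t v <= C `|rho'| t v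
     & C `|rho| 1 v = C `|rho'| 1 v].
  move=> v01.
  have [|h1 [p1 D1]] := dec `|rho| v _ v01; first by rewrite lexx; lra.
  have [|h2 [p2 D2]] := dec `|rho'| v _ v01; first by rewrite rr'; lra.
  exists h1, p1, h2, p2; split => //.
    move=> t t01; apply: (elliptical_copula_le hg hC r1' r'1 rr'); lra.
  have le01 : 0 <= (1 : R) <= 1 by lra.
  have v01' : 0 <= v <= 1 by lra.
  (* At u = 1 both Frechet-Hoeffding bounds equal v, including in the degenerate cases; this gives
     the equality of the total integrals. *)
  have one s : -1 <= s <= 1 -> C s 1 v = v.
    move=> s1; have := elliptical_family_frechet_bounds hC s1 le01 v01'.
    by rewrite ge_max le_min => /andP[/andP[? _] /andP[_ ?]]; lra.
  by rewrite !one.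
split=> v v0 v1.
- have v01 : 0 < v < 1 by rewrite v0.
  have [h1 [p1 [h2 [p2 [D1 D2 le12 eq12]]]]] := key v v01.
  have [S1 _] := elliptical_derivative_rearrangement hg hC hrho v01 D1.
  have [S2 _] := elliptical_derivative_rearrangement hg hC hrho' v01 D2.
  exact: schur_le_primitive S1 S2 D1 D2 le12 eq12.
- have v01 : 0 < v < 1 by rewrite v0.
  have [h1 [p1 [h2 [p2 [D1 D2 le12 eq12]]]]] := key v v01.
  have [_ S1] := elliptical_derivative_rearrangement hg hC hrho v01 D1.
  have [_ S2] := elliptical_derivative_rearrangement hg hC hrho' v01 D2.
  exact: schur_le_primitive S1 S2 D1 D2 le12 eq12.
Qed.
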